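(* Let $m,n\in\mathbb{N}$ satisfy $m\leq n$. Let $f$ be the random polynomial \[ f(x)=\sum_{k=0}^n\cos(kx)-\sum_{k=0}^m\varepsilon_k\cos(kx), \] where $\varepsilon_0,\ldots,\varepsilon_m\in\{0,1\}$ are independent Bernoulli random variables with $\mathbb{P}(\varepsilon_k=0)=\mathbb{P}(\varepsilon_k=1)=1/2$. Then \[ \mathbb{E}\,Z(f)=\Theta\left(\frac{n\log m}{\sqrt{m}}+m\right). \]
   Context: $Z(f)$ denotes the number of zeros of $f$ in the interval $[0,2\pi]$. $\Theta(\cdot)$ is the usual asymptotic notation (upper and lower bounds up to absolute positive constant factors).
   Formalization: The theorem is proved for 2 ≤ m ≤ n, since log m is undefined at m = 0 and the estimate fails at m = 1 (E Z(f) grows like n); the identically zero polynomial (m = n, all ε_k = 1) is counted as having 0 zeros, since E Z(f) would otherwise be infinite. *)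

(* Defs.v *)
From HB Require Import structures.
From mathcomp Require Import all_boot all_order all_algebra finmap.
From mathcomp Require Import all_classical all_reals all_analysis.

Set Implicit Arguments.
Unset Strict Implicit.
Unset Printing Implicit Defensive.

Import Order.TTheory GRing.Theory Num.Theory.

Local Open Scope classical_set_scope.
Local Open Scope ring_scope.

Definition zeros_0_2pi (R : realType) (f : R -> R) : set R :=
  [set x | 0 <= x <= 2 * pi /\ f x = 0].

(* Zeros are counted without multiplicity. [fset_set] sends an infinite set to
   the empty one, so the count is 0 when f has infinitely many zeros in
   [0, 2 pi]. A cosine polynomial has infinitely many only if it vanishes
   identically; for [random_cos_poly] below this is the single outcome
   m = n, eps = (1, ..., 1), on which the number of zeros is not a number. *)
Definition Z (R : realType) (f : R -> R) : nat :=
  #|` fset_set (zeros_0_2pi f) |%fset.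

Definition mutually_independent d (T : measurableType d) (R : realType)
    (P : probability T R) (I : finType) d' (U : measurableType d')
    (X : I -> {RV P >-> U}) : Prop :=
  forall (J : {set I}) (B : I -> set U),
    (forall i, measurable (B i)) ->
    P (\bigcap_(i in [set` J]) (X i @^-1` B i)) =
    (\prod_(i in J) P (X i @^-1` B i))%E.

(* Bernoulli(1/2) variables are boolean-valued; false and true stand for the
   values 0 and 1. *)
Definition bernoulli_half d (T : measurableType d) (R : realType)
    (P : probability T R) (e : {RV P >-> bool}) : Prop :=
  P (e @^-1` [set false]) = (2^-1)%:E /\ P (e @^-1` [set true]) = (2^-1)%:E.

Definition random_cos_poly d (T : measurableType d) (R : realType)
    (P : probability T R) (n m : nat) (eps : 'I_m.+1 -> {RV P >-> bool})
    (t : T) (x : R) : R :=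
  \sum_(0 <= k < n.+1) cos (k%:R * x)
  - \sum_(k < m.+1) (eps k t)%:R * cos (k%:R * x).

(* Main.v *)
Require Import Defs.
From HB Require Import structures.
From mathcomp Require Import all_boot all_order all_algebra finmap.
From mathcomp Require Import all_classical all_reals all_analysis.
From mathcomp Require Import measurable_realfun ring lra zify.

Set Implicit Arguments.
Unset Strict Implicit.
Unset Printing Implicit Defensive.

Import Order.TTheory GRing.Theory Num.Theory.
Import numFieldNormedType.Exports.

Local Open Scope classical_set_scope.
Local Open Scope ring_scope.

(** An outcome is encoded by the set A of those k for which the k-th Bernoulli
variable equals 1; independence makes A uniform over all subsets of
{0, ..., m}, so that the expectation is a finite average. Write
S = sum_{k in A} cos (k x), N = n + 1/2 and h = sin (x/2) (2 S - 1). The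
closed form of the Dirichlet kernel gives
    2 sin (x/2) f(x) = sin (N x) - h(x),
an oscillation of amplitude 1 and frequency N against a random function h of
degree at most m with random size about x sqrt m. Where |h| > 1 there is no
zero; where |h| < 1 there is about one zero in each half period of sin (N x).
Since P (|h(x)| <= 1) is about min (1, 1 / (x sqrt m)), summing over the grid
y_j = (j + 1/2) pi / N of extrema of sin (N x) produces n log m / sqrt m; the
oscillations of h itself account for the term m.

Upper bound. Between two zeros lies a root of 1 - h^2, a root of
N^2 (1 - h^2) - h'^2, or a grid point with |h| <= 1: without the first and the
third, asin (sin (N x)) - asin (h x) is differentiable and Rolle yields the
second ([breakpoint]). The first two are polynomials in cos x of degree O(m),
so the number of zeros is O(m) plus the number of grid points with |h| <= 1
([Z_le_low_grid]). The probability of the latter is bounded by the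
Littlewood-Offord inequality ([littlewood_offord], through the LYM inequality
[lym]), because one of |cos (k y)|, |cos (2 k y)| is at least 1/2
([prb_low_le]). When m = n, the degree alone bounds the number of zeros.

Lower bound by n log m / sqrt m. Consecutive grid points with |h| < 1 enclose
a zero, and passing from |h| < 1 to |h| >= 1 costs a root of 1 - h^2, so the
number of zeros is at least the number of grid points with |h| < 1, up to O(m)
([strict_low_grid_le]). The Rademacher sum X = 2 S - D_m, with D_m the
Dirichlet kernel, concentrates near 0 with the right probability
([prb_low_ge]): the even-indexed terms and the odd-indexed ones are almost
independent copies of each other, and two independent copies of a variable
collide at scale l with probability at least of order l / sqrt m, by the
pigeonhole principle ([collision]).

Lower bound by m. At the nodes 2 pi i / (2 m + 1) the values of X are almost
uncorrelated and have the same variance. The fourth moments then force, in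
each block of nine consecutive nodes, large values of both signs with
probability at least 1/100 ([prb_mixed_block]); such a block in [pi/2, pi]
contains a sign change of f.

Averaging the two lower bounds absorbs the O(m) loss in the first one. For
bounded m they are replaced by a single good outcome and by the grid points
next to 0, where |h| < 1 for every outcome ([avg_Z_lower_small]). *)

(** * Averages over a finite set *)

Section Average.
Context {R : realType} {T : finType}.
Implicit Types (g h : T -> R).

Definition avg g : R := (\sum_t g t) / #|T|%:R.
Definition prb (p : pred T) : R := avg (fun t => (p t)%:R).

Lemma eq_avg g h : g =1 h -> avg g = avg h.
Proof. by move=> gh; rewrite /avg; under eq_bigr do rewrite gh. Qed.

Lemma avgD g h : avg (fun t => g t + h t) = avg g + avg h.
Proof. by rewrite /avg big_split mulrDl. Qed.

Lemma avgZ (c : R) g : avg (fun t => c * g t) = c * avg g.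
Proof. by rewrite /avg -mulr_sumr mulrA. Qed.

Lemma avgN g : avg (fun t => - g t) = - avg g.
Proof. by rewrite /avg sumrN mulNr. Qed.

Lemma avg_sum (J : Type) (r : seq J) (p : pred J) (g : J -> T -> R) :
  avg (fun t => \sum_(j <- r | p j) g j t) = \sum_(j <- r | p j) avg (g j).
Proof. by rewrite /avg exchange_big mulr_suml. Qed.

Lemma ler_avg g h : (forall t, g t <= h t) -> avg g <= avg h.
Proof. by move=> gh; apply: ler_wpM2r; [rewrite invr_ge0 | apply: ler_sum]. Qed.

Lemma avg_ge0 g : (forall t, 0 <= g t) -> 0 <= avg g.
Proof. by move=> g0; apply: divr_ge0 => //; apply: sumr_ge0. Qed.

Lemma avg_reindex (f : T -> T) g : bijective f -> avg (g \o f) = avg g.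
Proof.
move=> fb; rewrite /avg; congr (_ / _); symmetry.
by apply: reindex; apply: onW_bij.
Qed.

Lemma avg_cst (c : R) : (0 < #|T|)%N -> avg (fun=> c) = c.
Proof.
move=> T0; rewrite /avg sumr_const -[c *+ _]mulr_natr mulfK //.
by rewrite pnatr_eq0 -lt0n.
Qed.

Lemma prb_ge0 (p : pred T) : 0 <= prb p.
Proof. by apply: avg_ge0 => t; case: (p t). Qed.

Lemma ler_prb (p q : pred T) : subpred p q -> prb p <= prb q.
Proof.
by move=> pq; apply: ler_avg => t; rewrite ler_nat; case: (p t) (pq t) => // ->.
Qed.

Lemma prb_cap (p q r : pred T) : (forall t, p t -> ~~ q t -> r t) ->
  prb p <= prb q + prb r.
Proof.
move=> pqr; rewrite -avgD; apply: ler_avg => t; rewrite -natrD ler_nat.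
by case: (p t) (pqr t) => //; case: (q t) => //= ->.
Qed.

Lemma prb_card (p : pred T) : prb p = #|p|%:R / #|T|%:R.
Proof.
rewrite /prb /avg -natr_sum -sum1_card; congr (_%:R / _).
by rewrite [RHS]big_mkcond /=; apply: eq_bigr => t _; rewrite unfold_in; case: (p t).
Qed.

Lemma markov_avg g (c : R) : 0 < c -> (forall t, 0 <= g t) ->
  prb (fun t => c <= g t) <= avg g / c.
Proof.
move=> c0 g0; rewrite ler_pdivlMr // mulrC -avgZ; apply: ler_avg => t.
by case: (leP c (g t)) => h; rewrite ?mulr1n ?mulr0n ?mulr1 ?mulr0.
Qed.

Lemma prb_le1 (p : pred T) : prb p <= 1.
Proof.
rewrite prb_card; case: (posnP #|T|) => [->|T0]; first by rewrite invr0 mulr0 ler01.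
by rewrite ler_pdivrMr ?ltr0n // mul1r ler_nat max_card.
Qed.

Lemma prb_compl (p : pred T) : (0 < #|T|)%N -> prb p + prb (fun t => ~~ p t) = 1.
Proof.
by move=> T0; rewrite -avgD -[RHS](@avg_cst 1 T0); apply: eq_avg => t;
  case: (p t); rewrite ?addr0 ?add0r.
Qed.

End Average.

Lemma ler_sum_in (R : realType) (J : eqType) (r : seq J) (F G : J -> R) :
  (forall j, j \in r -> F j <= G j) ->
  \sum_(j <- r) F j <= \sum_(j <- r) G j.
Proof. by move=> FG; rewrite big_seq [leRHS]big_seq; apply: ler_sum. Qed.

(** * Rademacher sums indexed by subsets *)

Section Rademacher.
Context {R : realType} {I : finType}.
Implicit Types (A B : {set I}) (a : I -> R) (k : I).

Definition rsgn A k : R := if k \in A then 1 else -1.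

Definition toggle k A : {set I} := [set i | (i \in A) (+) (i == k)].

Lemma toggleK k : involutive (toggle k).
Proof. by move=> A; apply/setP => i; rewrite !inE -addbA addbb addbF. Qed.

Lemma rsgn_toggle k A : rsgn (toggle k A) k = - rsgn A k.
Proof. by rewrite /rsgn inE eqxx addbT; case: (k \in A); rewrite ?opprK. Qed.

Lemma rsgn_toggle_neq k A i : i != k -> rsgn (toggle k A) i = rsgn A i.
Proof. by move=> /negPf ik; rewrite /rsgn inE ik addbF. Qed.

Lemma rsgn_sqr A k : rsgn A k ^+ 2 = 1.
Proof. by rewrite /rsgn; case: ifP; rewrite ?sqrrN expr1n. Qed.

Lemma rsgn_setC A k : rsgn (~: A) k = - rsgn A k.
Proof. by rewrite /rsgn inE; case: (k \in A); rewrite ?opprK. Qed.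

Lemma card_sets_gt0 : (0 < #|{set I}|)%N.
Proof. by apply/card_gt0P; exists finset.set0. Qed.

(** Flipping the sign with index k is a measure-preserving involution, so a
function that it negates has mean zero; all moments below reduce to this. *)
Lemma avg_odd k (g : {set I} -> R) : (forall A, g (toggle k A) = - g A) ->
  avg g = 0.
Proof.
move=> gk; have : avg g = - avg g.
  rewrite -avgN -[LHS](@avg_reindex _ _ (toggle k)); last first.
    by apply: inv_bij; exact: toggleK.
  by apply: eq_avg => A /=.
by lra.
Qed.

Definition rad (s : seq I) a A := \sum_(k <- s) a k * rsgn A k.

Lemma rad_toggle k s a A : k \notin s -> rad s a (toggle k A) = rad s a A.
Proof.
move=> ks; apply: eq_big_seq => i si; rewrite rsgn_toggle_neq //.
by apply: contraNneq ks => <-.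
Qed.

Lemma radC s a A : rad s a (~: A) = - rad s a A.
Proof.
by rewrite /rad -sumrN; apply: eq_bigr => k _; rewrite rsgn_setC mulrN.
Qed.

Lemma avg_rad2 s a : uniq s ->
  avg (fun A => rad s a A ^+ 2) = \sum_(k <- s) a k ^+ 2.
Proof.
elim: s => [_|k s IH /= /andP[ks us]].
  rewrite big_nil -[RHS](@avg_cst _ {set I} 0 card_sets_gt0).
  by apply: eq_avg => A; rewrite /rad big_nil expr0n.
rewrite big_cons -IH // -[X in X + _](@avg_cst _ {set I} _ card_sets_gt0).
rewrite -[LHS]subr0 -(@avg_odd k (fun A => 2 * (a k * rsgn A k * rad s a A))).
  rewrite -avgN -!avgD; apply: eq_avg => A.
  rewrite /rad big_cons; have := rsgn_sqr A k; move: (rsgn A k) => e e2.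
  rewrite sqrrD exprMn e2; ring.
by move=> A; rewrite rsgn_toggle rad_toggle // !(mulrN, mulNr).
Qed.

(** Only the even powers of the new sign survive, hence with V the variance so
far the fourth moment grows by 6 a^2 V + a^4, at most 3 (V + a^2)^2 - 3 V^2. *)
Lemma avg_rad4 s a : uniq s ->
  avg (fun A => rad s a A ^+ 4) <= 3 * (\sum_(k <- s) a k ^+ 2) ^+ 2.
Proof.
elim: s => [_|k s IH /= /andP[ks us]].
  rewrite big_nil expr0n mulr0 -[leRHS](@avg_cst _ {set I} 0 card_sets_gt0).
  by apply: ler_avg => A; rewrite /rad big_nil expr0n.
have := IH us; rewrite big_cons.
have := @avg_rad2 s a us; set V := \sum_(j <- s) _ => E2 E4.
have -> : avg (fun A => rad (k :: s) a A ^+ 4) =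
    a k ^+ 4 + 6 * a k ^+ 2 * V + avg (fun A => rad s a A ^+ 4).
  rewrite -E2 -[X in X + _ + _](@avg_cst _ {set I} _ card_sets_gt0).
  rewrite -avgZ -[LHS]subr0.
  rewrite -(@avg_odd k (fun A => 4 * (a k * rsgn A k * rad s a A ^+ 3
     + a k ^+ 3 * rsgn A k * rad s a A))).
    rewrite -avgN -!avgD; apply: eq_avg => A.
    rewrite /rad big_cons; set r := \sum_(_ <- _) _.
    have := rsgn_sqr A k; move: (rsgn A k) (a k) => e b e2.
    have e4 : e ^+ 4 = 1 by rewrite (exprM e 2 2) e2 expr1n.
    have e3 : e ^+ 3 = e by rewrite exprS e2 mulr1.
    transitivity (b ^+ 4 * e ^+ 4 + 6 * b ^+ 2 * e ^+ 2 * r ^+ 2 + r ^+ 4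
      + 4 * b ^+ 3 * (e ^+ 3 - e) * r); first by ring.
    by rewrite e4 e3 e2; ring.
  by move=> A; rewrite rsgn_toggle rad_toggle //; ring.
have := sqr_ge0 (a k); nra.
Qed.

Lemma chebyshev_rad s a (c : R) : uniq s -> 0 < c ->
  prb (fun A => c < `|rad s a A|) <= (\sum_(k <- s) a k ^+ 2) / c ^+ 2.
Proof.
move=> us c0; rewrite -(avg_rad2 a us).
apply: le_trans (@markov_avg _ _ (fun A => rad s a A ^+ 2) (c ^+ 2) _ _).
- apply: ler_prb => A /ltW h; rewrite -(ger0_norm (ltW c0)) in h.
  by rewrite -ler_sqr ?nnegrE // !real_normK ?num_real // in h.
- by rewrite exprn_gt0.
- by move=> A; exact: sqr_ge0.
Qed.

Definition mixset (E A B : {set I}) := (A :&: E) :|: (B :\: E).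

(** Exchanging the coordinates outside E between two independent uniform sets
preserves their joint law. This expresses the independence of the coordinates
in E from the others without conditioning. *)
Lemma avg_mix (E : {set I}) (g : {set I} -> {set I} -> R) :
  avg (fun A => avg (g A)) =
  avg (fun A => avg (fun B => g (mixset E A B) (mixset E B A))).
Proof.
rewrite /avg -!mulr_suml !pair_bigA /=; congr (_ / _ / _).
pose f (p : {set I} * {set I}) := (mixset E p.1 p.2, mixset E p.2 p.1).
rewrite (reindex f) //; apply: onW_bij; apply: inv_bij => -[A B].
rewrite /f /mixset /=; congr pair; apply/setP => i; rewrite !inE;
  by case: (i \in E); case: (i \in A); case: (i \in B).
Qed.

End Rademacher.

(** * From independent Bernoulli variables to the uniform average *)

Section Outcome.
Context {d : measure_display} {T : measurableType d} {R : realType}.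
Context {P : probability T R} {m : nat}.
Implicit Types eps : 'I_m.+1 -> {RV P >-> bool}.

Definition outcome eps (t : T) : {set 'I_m.+1} := [set k | eps k t].

Lemma outcome_fiber eps A :
  outcome eps @^-1` [set A] =
  \bigcap_(k in [set` [set: 'I_m.+1]%SET]) (eps k @^-1` [set k \in A]).
Proof.
apply/seteqP; split => t /= => [<- k _ /=|h]; first by rewrite inE.
by apply/setP => k; rewrite inE; apply: h; rewrite /= inE.
Qed.

Lemma measurable_outcome eps A : measurable (outcome eps @^-1` [set A]).
Proof.
rewrite outcome_fiber; apply: fin_bigcap_measurable => [|k _].
  exact: finite_finset.
by rewrite -[X in measurable X]setTI; exact: measurable_funP.
Qed.

Lemma outcome_uniform eps A : mutually_independent eps ->
  (forall k, bernoulli_half (eps k)) ->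
  P (outcome eps @^-1` [set A]) = (#|{set 'I_m.+1}|%:R^-1)%:E.
Proof.
move=> ind ber; rewrite outcome_fiber ind //.
have half k : P (eps k @^-1` [set k \in A]) = (2^-1)%:E.
  by have [h0 h1] := ber k; case: (k \in A).
rewrite (eq_bigr (fun=> (2^-1)%:E)) => [|k _]; last exact: half.
rewrite prodEFin prodr_const exprVn; congr _%:E; congr (_^-1).
by rewrite -natrX -cardsT -powersetT card_powerset.
Qed.

(** All probability in the theorem is discharged here: afterwards only
averages over the 2^(m+1) subsets occur. *)
Lemma expectation_outcome eps (g : {set 'I_m.+1} -> nat) :
  mutually_independent eps -> (forall k, bernoulli_half (eps k)) ->
  ('E_P[fun t => (g (outcome eps t))%:R%R])%E = (avg (fun A => (g A)%:R))%:E.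
Proof.
move=> ind ber; rewrite unlock /=.
under eq_integral => t _.
  have -> : (g (outcome eps t))%:R%:E = \sum_(A : {set 'I_m.+1})
      ((g A)%:R%:E * (\1_(outcome eps @^-1` [set A]) t)%:E)%E :> \bar R.
    rewrite (bigD1 (outcome eps t)) //= big1 ?adde0 => [|A /negPf At].
      by rewrite indicE mem_set // mule1.
    by rewrite indicE memNset ?mule0 //= => /esym/eqP; rewrite At.
  over.
rewrite ge0_integral_sum //; last first.
  move=> A; apply: measurable_funeM; apply/measurable_EFinP.
  exact/measurable_indic/measurable_outcome.
rewrite /avg mulr_suml -sumEFin; apply: eq_bigr => A _.
rewrite ge0_integralZl_EFin //; last first.
  apply/measurable_EFinP; exact/measurable_indic/measurable_outcome.
rewrite integral_indic //; last exact: measurable_outcome.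
by rewrite setIT EFinM; congr (_ * _)%E; exact: outcome_uniform.
Qed.

End Outcome.

(** * Trigonometric facts, Chebyshev polynomials and the Dirichlet kernel *)

Section Trigonometry.
Context {R : realType}.
Implicit Types (x y t : R) (n k : nat) (p q : {poly R}) (s : seq R).

Lemma sin_le_id t : 0 <= t -> sin t <= t.
Proof.
rewrite le_eqVlt => /predU1P[<-|t0]; first by rewrite sin0.
have [c _] := @MVT _ sin cos 0 t t0 (fun x _ => is_derive_sin x)
  (continuous_subspaceT (@continuous_sin R)).
rewrite sin0 !subr0 => ->.
by have := cos_le1 c; nra.
Qed.

Lemma sin_cos_pi4 : sin (pi / 4) = cos (pi / 4) :> R /\ (2^-1 : R) <= sin (pi / 4).
Proof.
have pi0 := pi_gt0 R.
have s0 : 0 < sin (pi / 4 : R) by apply: sin_gt0_pi; lra.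
have c0 : 0 < cos (pi / 4 : R) by apply: cos_gt0_pihalf; lra.
have := @cos_pihalf R; rewrite (_ : pi / 2 = pi / 4 + pi / 4 :> R); last by lra.
rewrite cosD; have := cos2Dsin2 (pi / 4 : R).
by split; nra.
Qed.

(** A weak form of Jordan's inequality. Below pi/4 the mean value theorem and
cos (pi/4) >= 1/2 suffice; above it, monotonicity of the sine does. *)
Lemma sin_ge_divpi t : 0 <= t <= pi / 2 -> t / pi <= sin t.
Proof.
have pi0 := pi_gt0 R; have pi2 := pi_ge2 R.
have [e4 h4] := sin_cos_pi4.
case/andP=> t0 t2; rewrite ler_pdivrMr //.
have [t4|t4] := leP t (pi / 4); last first.
  have : sin (pi / 4) < sin t by rewrite ltr_sin // in_itv /=; lra.
  by nra.
move: t0; rewrite le_eqVlt => /predU1P[<-|t0]; first by rewrite sin0 mul0r.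
have [c] := @MVT _ sin cos 0 t t0 (fun x _ => is_derive_sin x)
  (continuous_subspaceT (@continuous_sin R)).
rewrite sin0 !subr0 in_itv /= => /andP[c0 ct] ->.
have : cos (pi / 4) < cos c by rewrite ltr_cos ?in_itv /=; lra.
rewrite -e4 => h.
have : 1 <= cos c * pi by nra.
by nra.
Qed.

Lemma cos_step y k : `|cos (k.+1%:R * y) - cos (k%:R * y)| <= `|y|.
Proof.
wlog y0 : y / 0 <= y.
  move=> H; have [/H//|y0] := leP 0 y.
  by rewrite -(normrN y) -[cos (_ * y)]cosN -[X in _ - X]cosN -!mulrN H // oppr_ge0 ltW.
have -> : cos (k.+1%:R * y) - cos (k%:R * y) =
    - (2 * sin (k%:R * y + y / 2) * sin (y / 2)).
  rewrite (_ : k.+1%:R * y = (k%:R * y + y / 2) + y / 2); last first.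
    by rewrite -natr1; field.
  rewrite [X in _ - cos X](_ : _ = (k%:R * y + y / 2) - y / 2); last by ring.
  by rewrite cosD cosB; ring.
rewrite normrN !normrM (ger0_norm (ler0n _ 2)) (ger0_norm y0).
have h2 : `|sin (y / 2)| <= y / 2.
  have : sin (y / 2) <= y / 2 by apply: sin_le_id; lra.
  have [y2|y2] := leP y 2.
    by move=> ?; rewrite ger0_norm // sin_ge0_pi //; have := pi_ge2 R; lra.
  by move=> _; apply: le_trans (sin_max _) _; lra.
have := sin_max (k%:R * y + y / 2); have := normr_ge0 (sin (y / 2)); nra.
Qed.

Lemma cos_double_nat y k : cos ((k.*2)%:R * y) = 2 * cos (k%:R * y) ^+ 2 - 1.
Proof.
rewrite -muln2 natrM (_ : _ * y = k%:R * y + k%:R * y); last by ring.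
by rewrite cosD; have := cos2Dsin2 (k%:R * y); nra.
Qed.

Fixpoint cheb n : {poly R} :=
  match n with
  | 0 => 1
  | 1 => 'X
  | (n'.+1 as k).+1 => 2%:P * 'X * cheb k - cheb n'
  end.

Lemma horner_cheb n x : (cheb n).[cos x] = cos (n%:R * x).
Proof.
suff: (cheb n).[cos x] = cos (n%:R * x) /\
    (cheb n.+1).[cos x] = cos (n.+1%:R * x) by case.
elim: n => [|n [h1 h2]]; first by rewrite /= hornerC hornerX mul0r cos0 mul1r.
split=> //; rewrite [cheb _.+2]/= -/(cheb n.+1) hornerD hornerN !hornerM h1 h2.
rewrite hornerC hornerX.
rewrite (_ : n.+2%:R * x = n.+1%:R * x + x); last by rewrite -[in LHS]natr1; ring.
rewrite (_ : n%:R * x = n.+1%:R * x - x); last by rewrite -[in RHS]natr1; ring.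
by rewrite [cos (_ - _)]cosB [cos (_ + _)]cosD; ring.
Qed.

Lemma size_cheb n : (size (cheb n) <= n.+1)%N.
Proof.
suff: (size (cheb n) <= n.+1)%N /\ (size (cheb n.+1) <= n.+2)%N by case.
elim: n => [|n [h1 h2]]; first by rewrite /= size_polyC size_polyX oner_eq0.
split=> //; rewrite [cheb _.+2]/= -/(cheb n.+1).
apply: leq_trans (size_polyD _ _) _; rewrite size_polyN geq_max.
rewrite (leq_trans h1) ?andbT; last by lia.
rewrite -mulrA mul_polyC; apply: leq_trans (size_scale_leq _ _) _.
by apply: leq_trans (size_polyMleq _ _) _; rewrite size_polyX.
Qed.

(** The cosine is injective on [0, pi], so distinct zeros there give distinct
roots of p. *)
Lemma cos_poly_roots p s : p != 0 -> uniq s ->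
  (forall x, x \in s -> 0 <= x <= pi /\ p.[cos x] = 0) -> (size s < size p)%N.
Proof.
move=> p0 us sP; rewrite -(size_map cos); apply: max_poly_roots => //.
  by apply/allP => _ /mapP[x /sP[_ px] ->]; apply/rootP.
rewrite map_inj_in_uniq // => x y /sP[x0 _] /sP[y0 _].
by apply: cos_inj; rewrite in_itv.
Qed.

Definition dir n x : R := \sum_(0 <= k < n.+1) cos (k%:R * x).

(** Closed form of the Dirichlet kernel, multiplied out to avoid dividing by
sin (x/2). *)
Lemma dirichletE n x :
  2 * sin (x / 2) * dir n x = sin (x / 2) + sin ((n%:R + 2^-1) * x).
Proof.
elim: n => [|n IH].
  rewrite /dir big_nat1 mul0r cos0 add0r mulrC mul1r (mulrC _ x) mulr_natl.
  by rewrite mulr2n.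
rewrite /dir big_nat_recr //= mulrDr -/(dir n x) IH -addrA; congr (_ + _).
rewrite [X in sin X + _](_ : _ = n.+1%:R * x - x / 2); last by rewrite -natr1; field.
rewrite [RHS](_ : _ = sin (n.+1%:R * x + x / 2)); last by congr sin; field.
by rewrite sinB sinD; ring.
Qed.

Lemma sin_cos_2pi x : sin (2 * pi - x) = - sin x /\ cos (2 * pi - x) = cos x :> R.
Proof.
rewrite mulr_natl sinB cosB sin2pi cos2pi.
by split; ring.
Qed.

Lemma sin_alt n : sin (n%:R * pi + pi / 2) = (-1) ^+ n :> R.
Proof.
elim: n => [|n IH]; first by rewrite mul0r add0r sin_pihalf expr0.
rewrite -natr1 mulrDl mul1r addrAC sinDpi IH exprS mulN1r.
by [].
Qed.

Lemma cos_eq0_nat t : 0 <= t -> cos t = 0 -> exists n, t = (n%:R + 2^-1) * pi.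
Proof.
have pi0 := pi_gt0 R; move=> t0 ct; pose n := Num.truncn (t / pi).
have /andP[h1 h2] := truncn_itv (divr_ge0 t0 (ltW pi0)).
rewrite -/n ler_pdivlMr // ltr_pdivrMr // in h1 h2.
exists n; rewrite mulrDl -[LHS](subrK (n%:R * pi)) addrC; congr (_ + _).
have cn : cos (t - n%:R * pi) = 0.
  have sn : sin (n%:R * pi) = 0 :> R.
    elim: (n) => [|k IH]; first by rewrite mul0r sin0.
    by rewrite -natr1 mulrDl mul1r sinDpi IH oppr0.
  by rewrite cosB ct sn; ring.
rewrite (mulrC 2^-1); apply: cos_inj; rewrite ?in_itv /=.
- by rewrite -natr1 in h2; apply/andP; split; lra.
- by apply/andP; split; lra.
- by rewrite cn cos_pihalf.
Qed.

End Trigonometry.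

(** * The oscillation sin (N x) against the slow function h *)

Section CosinePolynomial.
Context {R : realType} {m : nat}.
Implicit Types (A : {set 'I_m.+1}) (x : R) (n : nat).

Definition csum A x : R := \sum_(k in A) cos (k%:R * x).
Definition outcome_poly n A x : R := dir n x - csum A x.
Definition cpoly A : {poly R} := \sum_(k in A) cheb k.
Definition gpoly A : {poly R} := 2%:P * cpoly A - 1.
(** The slow part h in the decomposition of 2 sin (x/2) f(x); see
[outcome_poly_sin]. *)
Definition hfun A x : R := sin (x / 2) * (2 * csum A x - 1).

Lemma horner_cpoly A x : (cpoly A).[cos x] = csum A x.
Proof. by rewrite horner_sum; apply: eq_bigr => k _; exact: horner_cheb. Qed.

Lemma size_cpoly A : (size (cpoly A) <= m.+1)%N.
Proof.
apply: leq_trans (size_sum _ _ _) _; apply/bigmax_leqP => k _.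
by apply: leq_trans (size_cheb _) _.
Qed.

Lemma horner_gpoly A x : (gpoly A).[cos x] = 2 * csum A x - 1.
Proof. by rewrite /gpoly !(hornerE, horner_cpoly). Qed.

Lemma size_gpoly A : (size (gpoly A) <= m.+1)%N.
Proof.
apply: leq_trans (size_polyD _ _) _; rewrite size_polyN size_polyC oner_eq0.
rewrite geq_max andbT mul_polyC; apply: leq_trans (size_scale_leq _ _) _.
exact: size_cpoly.
Qed.

Lemma outcome_poly_sin n A x :
  2 * sin (x / 2) * outcome_poly n A x = sin ((n%:R + 2^-1) * x) - hfun A x.
Proof. by rewrite /outcome_poly mulrBr dirichletE /hfun; ring. Qed.

Lemma outcome_polyE n A x : outcome_poly n A x =
  (\sum_(0 <= k < n.+1) cheb k - cpoly A).[cos x].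
Proof.
rewrite hornerD hornerN horner_cpoly horner_sum /outcome_poly; congr (_ - _).
by apply: eq_bigr => k _; rewrite horner_cheb.
Qed.

Lemma size_outcome_poly n A : (m <= n)%N ->
  (size (\sum_(0 <= k < n.+1) cheb k - cpoly A)%R <= n.+1)%N.
Proof.
move=> mn; apply: leq_trans (size_polyD _ _) _; rewrite size_polyN geq_max.
rewrite (leq_trans (size_cpoly A)) // andbT.
rewrite big_mkord; apply: leq_trans (size_sum _ _ _) _.
by apply/bigmax_leqP => k _; apply: leq_trans (size_cheb _) _.
Qed.

Lemma outcome_poly_sym n A x : outcome_poly n A (2 * pi - x) = outcome_poly n A x.
Proof. by rewrite !outcome_polyE (sin_cos_2pi x).2. Qed.

Lemma sin_half_sqr x : sin (x / 2) ^+ 2 = (1 - cos x) / 2.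
Proof.
rewrite [in RHS](_ : x = x / 2 + x / 2); last by field.
by rewrite cosD; have := cos2Dsin2 (x / 2); nra.
Qed.

Lemma cos_half_sqr x : cos (x / 2) ^+ 2 = (1 + cos x) / 2.
Proof.
rewrite [in RHS](_ : x = x / 2 + x / 2); last by field.
by rewrite cosD; have := cos2Dsin2 (x / 2); nra.
Qed.

Lemma sin_half_double x : sin x = 2 * sin (x / 2) * cos (x / 2).
Proof.
rewrite [in LHS](_ : x = x / 2 + x / 2); last by field.
by rewrite sinD; ring.
Qed.

Definition dhfun A x : R := cos (x / 2) / 2 * (gpoly A).[cos x] -
  sin (x / 2) * sin x * (gpoly A)^`().[cos x].

Lemma is_derive_hfun A x : is_derive x 1 (hfun A) (dhfun A x).
Proof.
have -> : hfun A = (sin \o ( *%R 2^-1)) * (horner (gpoly A) \o cos).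
  by apply/funext => y; rewrite /hfun -horner_gpoly mulrC [y / 2]mulrC mulrC.
have d1 : is_derive x 1 ( *%R (2^-1 : R)) (2^-1).
  have -> : *%R (2^-1 : R) = horner (2^-1 *: 'X).
    by apply/funext => y; rewrite hornerZ hornerX.
  have := is_derive_poly (2^-1 *: 'X) x.
  by rewrite derivZ derivX hornerZ hornerC mulr1.
have d2 := @is_derive1_comp _ sin ( *%R 2^-1) x _ _ (is_derive_sin _) d1.
have d3 := @is_derive1_comp _ (horner (gpoly A)) cos x _ _ (is_derive_poly _ _)
  (is_derive_cos x).
have := is_deriveM d2 d3; set e := (X in is_derive _ _ _ X); suff -> : e = dhfun A x by [].
rewrite {}/e.
by rewrite /dhfun /GRing.scale /= [2^-1 * x]mulrC; ring.
Qed.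

(** The function 1 - h^2 as a polynomial in cos x: the half angles disappear
because sin (x/2)^2 = (1 - cos x) / 2. *)
Definition level_poly A : {poly R} := 1 - (2^-1)%:P * (1 - 'X) * gpoly A ^+ 2.

(** The function N^2 (1 - h^2) - h'^2 as a polynomial in cos x. It vanishes where
the graphs of asin h and of asin (sin (N x)) have slopes of equal size. *)
Definition tangency_poly n A : {poly R} :=
  ((n%:R + 2^-1) ^+ 2)%:P * level_poly A
  - ((8^-1)%:P * (1 + 'X) * gpoly A ^+ 2
     - (2^-1)%:P * (1 - 'X^2) * (gpoly A * (gpoly A)^`())
     + (2^-1)%:P * ((1 - 'X) * (1 - 'X^2)) * (gpoly A)^`() ^+ 2).

Lemma horner_level A x : (level_poly A).[cos x] = 1 - hfun A x ^+ 2.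
Proof.
rewrite /hfun exprMn sin_half_sqr -horner_gpoly /level_poly.
move: (gpoly A) => g; rewrite !(hornerD, hornerN, hornerM, hornerC, hornerX, hornerXn, horner_exp).
by field.
Qed.

Lemma horner_tangency n A x : (tangency_poly n A).[cos x] =
  (n%:R + 2^-1) ^+ 2 * (1 - hfun A x ^+ 2) - dhfun A x ^+ 2.
Proof.
rewrite -horner_level /tangency_poly /dhfun.
move: (gpoly A) (level_poly A) => G L; rewrite !(hornerD, hornerN, hornerM, hornerC, hornerX, hornerXn, horner_exp).
set g := G.[cos x]; set g' := G^`().[cos x].
have -> : (cos (x / 2) / 2 * g - sin (x / 2) * sin x * g') ^+ 2 =
  cos (x / 2) ^+ 2 / 4 * g ^+ 2 - (2 * sin (x / 2) * cos (x / 2)) * sin x / 2 * g * g'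
  + sin (x / 2) ^+ 2 * sin x ^+ 2 * g' ^+ 2 by field.
rewrite -sin_half_double cos_half_sqr sin_half_sqr.
have -> : - (sin x * sin x / 2 * g * g') = - (sin x ^+ 2 / 2 * g * g') by ring.
by rewrite sin2cos2; field.
Qed.

Lemma size_polyM_le (p q : {poly R}) a b :
  (size p <= a.+1)%N -> (size q <= b.+1)%N -> (size (p * q)%R <= (a + b).+1)%N.
Proof. by move=> pa qb; apply: leq_trans (size_polyMleq _ _) _; lia. Qed.

Lemma size_polyD_le (p q : {poly R}) a :
  (size p <= a)%N -> (size q <= a)%N -> (size (p + q)%R <= a)%N.
Proof. by move=> pa qa; apply: leq_trans (size_polyD _ _) _; rewrite geq_max pa. Qed.

Lemma size_polyN_le (p : {poly R}) a : (size p <= a)%N -> (size (- p)%R <= a)%N.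
Proof. by rewrite size_polyN. Qed.

Lemma size_1X : (size (1 - 'X : {poly R})%R <= 2)%N /\ (size (1 + 'X : {poly R})%R <= 2)%N
  /\ (size (1 - 'X^2 : {poly R})%R <= 3)%N.
Proof.
split; last split; apply: size_polyD_le; rewrite ?size_polyN ?size_polyXn ?size_polyX //.
all: by rewrite size_polyC oner_eq0.
Qed.

Lemma size_level A : (size (level_poly A) <= (m.*2).+4)%N.
Proof.
have [s1 [s2 s3]] := size_1X; have sg := size_gpoly A.
apply: size_polyD_le; first by rewrite size_polyC oner_eq0.
apply: size_polyN_le; rewrite -mulrA mul_polyC.
apply: leq_trans (size_scale_leq _ _) _; rewrite expr2.
apply: leq_trans (size_polyM_le s1 (size_polyM_le sg sg)) _; lia.
Qed.

Lemma size_tangency n A : (size (tangency_poly n A) <= (m.*2).+4)%N.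
Proof.
have [s1 [s2 s3]] := size_1X; have sg := size_gpoly A.
have sd : (size (gpoly A)^`() <= m.+1)%N.
  by apply: leq_trans (size_poly _ _) _; move: sg; case: (size _) => //= k; lia.
apply: size_polyD_le.
  by rewrite mul_polyC; apply: leq_trans (size_scale_leq _ _) (size_level A).
apply: size_polyN_le; rewrite -!mulrA !mul_polyC.
apply: size_polyD_le; first apply: size_polyD_le; last 2 first.
- apply: size_polyN_le; apply: leq_trans (size_scale_leq _ _) _.
  by apply: leq_trans (size_polyM_le s3 (size_polyM_le sg sd)) _; lia.
- apply: leq_trans (size_scale_leq _ _) _.
  by apply: leq_trans (size_polyM_le s1 (size_polyM_le s3 (size_polyM_le sd sd))) _; lia.
- apply: leq_trans (size_scale_leq _ _) _.
  by apply: leq_trans (size_polyM_le s2 (size_polyM_le sg sg)) _; lia.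
Qed.

Lemma level_neq0 A : level_poly A != 0.
Proof.
apply/eqP => /(congr1 (fun p => p.[cos 0])); rewrite horner_level horner0 /hfun.
by rewrite mul0r sin0 mul0r expr0n subr0 => /eqP; rewrite oner_eq0.
Qed.

(** At x = 0 the value is N^2 - h'(0)^2, and |h'(0)| <= m + 1/2 < N. For
m = n the polynomial can vanish identically, namely when f does. *)
Lemma tangency_neq0 n A : (m < n)%N -> tangency_poly n A != 0.
Proof.
move=> mn; apply/eqP => /(congr1 (fun p => p.[cos 0])).
rewrite horner_tangency horner0 /hfun /dhfun horner_gpoly /csum.
rewrite mul0r sin0 cos0 !mul0r expr0n subr0 !subr0 mulr1.
under eq_bigr do rewrite mulr0 cos0.
rewrite sumr_const => /eqP; rewrite subr_eq0 => /eqP.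
have : (#|A| <= m.+1)%N by rewrite -[leqRHS]card_ord max_card.
move: #|A| => k; rewrite -(ler_nat R) -natr1 => km.
have := ler0n R k; have := ler0n R m.
by move: mn km; rewrite -(@ltr_nat R); move: (m%:R) (n%:R) (k%:R) => a b c; nra.
Qed.

End CosinePolynomial.

(** * Counting zeros by finite sequences *)

Section ZeroCount.
Context {R : realType}.

Lemma uniq_zeros_finite (A : set R) (K : nat) :
  (forall s : seq R, uniq s -> (forall x, x \in s -> A x) -> (size s <= K)%N) ->
  finite_set A.
Proof.
move=> AK; apply: contrapT => /(infinite_set_fset K.+1)[B BA].
by rewrite ltnNge AK // ?fset_uniq // => x xB; apply: BA.
Qed.

Lemma Z_le (f : R -> R) (K : nat) :
  (forall s : seq R, uniq s -> (forall x, x \in s -> 0 <= x <= 2 * pi /\ f x = 0) ->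
    (size s <= K)%N) -> (Z f <= K)%N.
Proof.
move=> fK; rewrite /Z; apply: (fK) => [|x]; first exact: fset_uniq.
have fin : finite_set (zeros_0_2pi f) by apply: (@uniq_zeros_finite _ K) => s; exact: fK.
by rewrite in_fset_set // inE.
Qed.

Lemma Z_ge (f : R -> R) (K : nat) (s : seq R) :
  (forall s : seq R, uniq s -> (forall x, x \in s -> 0 <= x <= 2 * pi /\ f x = 0) ->
    (size s <= K)%N) ->
  uniq s -> (forall x, x \in s -> 0 <= x <= 2 * pi /\ f x = 0) -> (size s <= Z f)%N.
Proof.
move=> fK us sf; rewrite /Z; apply: uniq_leq_size => // x xs.
have fin : finite_set (zeros_0_2pi f) by apply: (@uniq_zeros_finite _ K) => t; exact: fK.
by rewrite in_fset_set // inE; exact: sf.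
Qed.

Lemma Z_infinite (f : R -> R) : (forall x, f x = 0) -> Z f = 0%N.
Proof.
move=> f0; rewrite /Z /fset_set; case: pselect => // fin; exfalso.
have pi0 := pi_gt0 R.
suff : infinite_set (zeros_0_2pi f) by [].
have gI : injective (fun k : nat => (k.+1%:R : R)^-1 * pi).
  by move=> i j /(mulIf (lt0r_neq0 pi0))/invr_inj/eqP; rewrite eqr_nat => /eqP[].
apply/infinite_set_fsetP => k.
exists [fset (i.+1%:R : R)^-1 * pi | i in iota 0 k]%fset; last first.
  rewrite card_in_imfset /=; last by move=> i j _ _; exact: gI.
  by rewrite undup_id ?iota_uniq // size_iota.
move=> x /= /imfsetP[i _ ->]; split => //.
rewrite mulr_ge0 ?(ltW pi0) ?invr_ge0 //= ler_pM2r //.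
by rewrite (@le_trans _ _ 1) ?ler1n // invf_le1 ?ler1n ?ltr0n.
Qed.

(** The breakpoints of the 1st and 2nd element, of the 3rd and 4th, and so on,
lie in disjoint intervals, so at least half of the elements are accounted for.
Pairing is needed because a breakpoint may be an endpoint of its interval. *)
Lemma sorted_breakpoints (P : R -> Prop) (s : seq R) : sorted <%R s ->
  (forall a b, a \in s -> b \in s -> a < b -> exists2 c, a <= c <= b & P c) ->
  exists t : seq R, [/\ sorted <%R t,
    forall c, c \in t -> P c /\ (exists2 a, a \in s & a <= c) &
    (size s <= (size t).*2.+1)%N].
Proof.
have [k] := ubnP (size s); elim: k s => // k IH [|a [|b s]] /= sk ss sP.
- by exists [::].
- by exists [::].
move: ss => /andP[ab]; rewrite (path_sortedE lt_trans) => /andP[/allP bs ss].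
have [||t [st tP ts]] := IH s _ ss; first by lia.
  by move=> x y xs ys; apply: sP; rewrite !inE ?xs ?ys !orbT.
have [||c /andP[ac cb] Pc] := sP a b _ _ ab; rewrite ?inE ?eqxx ?orbT //.
exists (c :: t); split => /=; last by lia.
  rewrite (path_sortedE lt_trans) st andbT; apply/allP => d /tP[_ [e es ed]].
  by apply: le_lt_trans cb _; apply: lt_le_trans ed; exact: bs.
move=> d; rewrite inE => /predU1P[->|/tP[Pd [e es ed]]].
  by split=> //; exists a; rewrite ?inE ?eqxx.
by split=> //; exists e; rewrite // !inE es !orbT.
Qed.

Lemma uniq_half_zeros (f : R -> R) (K : nat) (s : seq R) :
  (forall x, f (2 * pi - x) = f x) ->
  (forall s : seq R, uniq s -> (forall x, x \in s -> 0 <= x <= pi /\ f x = 0) ->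
    (size s <= K)%N) ->
  uniq s -> (forall x, x \in s -> 0 <= x <= 2 * pi /\ f x = 0) ->
  (size s <= K.*2)%N.
Proof.
move=> fsym fK us sf; rewrite -addnn -(count_predC (fun x => x <= pi)).
apply: leq_add; rewrite -size_filter.
  apply: fK; first exact: filter_uniq.
  by move=> x; rewrite mem_filter => /andP[-> /sf[/andP[-> _]]].
rewrite -(size_map (fun x => 2 * pi - x)); apply: fK.
  rewrite map_inj_uniq ?filter_uniq // => x y /addrI/oppr_inj.
  by [].
move=> _ /mapP[x + ->]; rewrite mem_filter fsym /= -ltNge => /andP[px].
by move=> /sf[/andP[x0 x2] ->]; split=> //; apply/andP; split; lra.
Qed.

End ZeroCount.

(** * Zeros are controlled by breakpoints *)

Section ZeroUpper.
Context {R : realType} {m : nat}.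
Implicit Types (A : {set 'I_m.+1}) (x : R) (n : nat).

Lemma outcome_poly_uniq_zeros n A : (m <= n)%N ->
  (exists x : R, outcome_poly n A x != 0) ->
  forall s : seq R, uniq s ->
    (forall x, x \in s -> 0 <= x <= 2 * pi /\ outcome_poly n A x = 0) ->
  (size s <= n.*2)%N.
Proof.
move=> mn [x0 fx0] s; apply: uniq_half_zeros; first exact: outcome_poly_sym.
move=> {}s us sP; rewrite -ltnS; apply: leq_trans (@size_outcome_poly R m n A mn).
apply: cos_poly_roots => //; last by move=> x /sP; rewrite outcome_polyE.
by apply: contraNneq fx0 => p0; rewrite outcome_polyE p0 horner0.
Qed.

Lemma Z_le_degree n A : (m <= n)%N -> (Z (@outcome_poly R m n A) <= n.*2)%N.
Proof.
move=> mn; have [h|h] := pselect (exists x : R, outcome_poly n A x != 0).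
  by apply: Z_le; exact: outcome_poly_uniq_zeros.
rewrite Z_infinite // => x; apply/eqP; apply: contrapT => /negP fx.
by apply: h; exists x.
Qed.

(** The extrema of sin (N x) in (0, pi], at which sin (N x) = (-1)^j. *)
Definition grid n j : R := (j%:R + 2^-1) * pi / (n%:R + 2^-1).

Lemma grid_gt0 n j : 0 < grid n j.
Proof. by rewrite divr_gt0 ?mulr_gt0 ?pi_gt0 // ltr_wpDl. Qed.

Lemma grid_le n i j : (i <= j)%N -> grid n i <= grid n j.
Proof.
move=> ij; rewrite /grid ler_pM2r ?invr_gt0 ?ltr_wpDl //.
by rewrite ler_pM2r ?pi_gt0 // lerD2r ler_nat.
Qed.

Lemma grid_lt n i j : (i < j)%N -> grid n i < grid n j.
Proof.
move=> ij; rewrite /grid ltr_pM2r ?invr_gt0 ?ltr_wpDl //.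
by rewrite ltr_pM2r ?pi_gt0 // ltrD2r ltr_nat.
Qed.

Lemma grid_max n : grid n n = pi.
Proof. by rewrite /grid mulrAC divff ?mul1r // gt_eqF // ltr_wpDl. Qed.

Lemma sin_grid n j : sin ((n%:R + 2^-1) * grid n j) = (-1) ^+ j.
Proof.
rewrite /grid mulrC divfK ?gt_eqF ?ltr_wpDl // mulrDl [2^-1 * _]mulrC.
exact: sin_alt.
Qed.

Lemma continuous_hfun A : continuous (@hfun R m A).
Proof.
move=> x; apply/differentiable_continuous/derivable1_diffP.
by have := is_derive_hfun A x => -[].
Qed.

Lemma level_root A (a b : R) : a <= b ->
  (hfun A a ^+ 2 <= 1 <= hfun A b ^+ 2) \/ (hfun A b ^+ 2 <= 1 <= hfun A a ^+ 2) ->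
  exists2 c : R, a <= c <= b & hfun A c ^+ 2 = 1.
Proof.
move=> ab h.
have [||c + hc] := @IVT _ (fun x => hfun A x ^+ 2) a b 1 ab.
- apply: continuous_subspaceT => x.
  by apply: continuousM; exact: continuous_hfun.
- rewrite ge_min le_max; move: h => [/andP[-> ->]|/andP[-> ->]]; rewrite ?orbT //.
by rewrite in_itv /= => cab; exists c.
Qed.

(** If there is no root of 1 - h^2 on [a, b], then |h| < 1 there, since
|h(a)| = |sin (N a)| <= 1. If moreover no grid point lies in [a, b], then
cos (N x) has no zero and asin (sin (N x)) - asin (h x) is differentiable. It
vanishes at a and b; where its derivative vanishes, the squares of the two
slopes agree, which is a root of the tangency polynomial. *)
Lemma breakpoint n A (a b : R) : 0 <= a -> a < b -> b <= pi ->
  hfun A a = sin ((n%:R + 2^-1) * a) -> hfun A b = sin ((n%:R + 2^-1) * b) ->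
  exists2 c, a <= c <= b &
    [\/ (level_poly A).[cos c] = 0, (tangency_poly n A).[cos c] = 0 |
        exists j, [/\ (j <= n)%N, c = grid n j & `|hfun A c| <= 1]].
Proof.
set N : R := n%:R + 2^-1.
have N0 : 0 < N by rewrite ltr_wpDl.
move=> a0 ab bpi ha hb.
have [[c cab c0]|nolev] := pselect (exists2 c : R, a <= c <= b & hfun A c ^+ 2 = 1).
  by exists c => //; apply: Or31; rewrite horner_level c0 subrr.
have h1 x : a <= x <= b -> hfun A x ^+ 2 < 1.
  move=> /andP[ax xb]; rewrite ltNge; apply/negP => x1; apply: nolev.
  have [|c /andP[ac cx] c1] := @level_root A a x ax.
    left; rewrite x1 andbT ha sin2cos2; have := sqr_ge0 (cos (N * a)); lra.
  by exists c => //; rewrite ac (le_trans cx).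
have [[x /andP[ax xb] x0]|nogrid] :=
    pselect (exists2 x, a <= x <= b & cos (N * x) = 0).
  have x_ge0 := le_trans a0 ax.
  have [j jE] := cos_eq0_nat (mulr_ge0 (ltW N0) x_ge0) x0.
  exists x; rewrite ?ax //; apply: Or33; exists j.
  have xE : x = grid n j by rewrite /grid -jE mulrC mulKf // gt_eqF.
  split=> //; last first.
    rewrite -(@ler_pXn2r _ 2) ?nnegrE // expr1n real_normK ?num_real //.
    by rewrite ltW // h1 // ax.
  have : grid n j <= grid n n by rewrite -xE grid_max (le_trans xb).
  by apply: contraTT; rewrite -ltnNge -ltNge; exact: grid_lt.
(* Composing with asin on both sides turns the equation sin (N x) = h(x) into
   one between functions whose derivatives have square N^2 and h'^2 / (1 - h^2). *)
pose u x := asin (sin (N * x)) - asin (hfun A x).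
have rng (y : R) : y ^+ 2 < 1 -> -1 < y < 1 by move=> ?; apply/andP; split; nra.
have s1 x : a <= x <= b -> sin (N * x) ^+ 2 < 1.
  move=> xab; rewrite sin2cos2.
  suff : 0 < cos (N * x) ^+ 2 by lra.
  by rewrite exprn_even_gt0 //=; apply/eqP => c0; apply: nogrid; exists x.
pose du x := (Num.sqrt (1 - sin (N * x) ^+ 2))^-1 * (cos (N * x) * N)
  - (Num.sqrt (1 - hfun A x ^+ 2))^-1 * dhfun A x.
have dE x : a <= x <= b -> is_derive x 1 u (du x).
  move=> xab.
  have d1 : is_derive x 1 ( *%R N) N.
    have -> : *%R N = horner (N *: 'X).
      by apply/funext => y; rewrite hornerZ hornerX.
    have := is_derive_poly (N *: 'X) x.
    by rewrite derivZ derivX hornerZ hornerC mulr1.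
  have d2 := @is_derive1_comp _ sin ( *%R N) x _ _ (is_derive_sin _) d1.
  have d3 := @is_derive1_comp _ asin (sin \o *%R N) x _ _
     (is_derive1_asin (rng _ (s1 x xab))) d2.
  have d4 := @is_derive1_comp _ asin (hfun A) x _ _
     (is_derive1_asin (rng _ (h1 x xab))) (is_derive_hfun A x).
  exact: (is_deriveB d3 d4).
have [||| c cab dc] := @Rolle _ u a b ab.
- by move=> x; rewrite in_itv /= => /andP[ax xb]; have [] := dE x; rewrite ?(ltW ax) ?(ltW xb).
- apply: derivable_within_continuous => x; rewrite in_itv /= => xab.
  by have [] := dE x.
- by rewrite /u ha hb !subrr.
rewrite in_itv /= in cab; move: cab => /andP[/ltW ac /ltW cb].
have cab : a <= c <= b by rewrite ac.
exists c => //; apply: Or32; rewrite horner_tangency -/N.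
have : du c = 0.
  have [_ <-] := dE c cab.
  by have [_ <-] := dc.
have := h1 c cab; have := s1 c cab; rewrite /du.
rewrite -cos2sin2; set C := cos (N * c) => _ hc /eqP.
have C0 : C != 0 by apply/eqP => c0; apply: nogrid; exists c.
have X2 : Num.sqrt (C ^+ 2) ^+ 2 = C ^+ 2 by rewrite sqr_sqrtr // sqr_ge0.
have Y2 : Num.sqrt (1 - hfun A c ^+ 2) ^+ 2 = 1 - hfun A c ^+ 2.
  by rewrite sqr_sqrtr // subr_ge0 ltW.
have X0 : Num.sqrt (C ^+ 2) != 0 by rewrite sqrtr_eq0 -ltNge exprn_even_gt0.
have Y0 : Num.sqrt (1 - hfun A c ^+ 2) != 0.
  by rewrite sqrtr_eq0 -ltNge subr_gt0.
move: X2 Y2 X0 Y0; set X := Num.sqrt (C ^+ 2); set Y := Num.sqrt _.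
move=> X2 Y2 X0 Y0; rewrite subr_eq0 => /eqP e.
have e2 : C * N * Y = X * dhfun A c.
  apply: (mulfI (mulf_neq0 (invr_neq0 X0) (invr_neq0 Y0))).
  transitivity (X^-1 * (C * N)); first by field; rewrite X0 Y0.
  by rewrite e; field; rewrite X0 Y0.
have e3 : C ^+ 2 * (N ^+ 2 * Y ^+ 2 - dhfun A c ^+ 2) = 0.
  transitivity ((C * N * Y) ^+ 2 - C ^+ 2 * dhfun A c ^+ 2); first by ring.
  by rewrite e2 exprMn X2 subrr.
move/eqP: e3; rewrite mulf_eq0 expf_eq0 /= (negPf C0) /= Y2.
by move=> /eqP.
Qed.

Definition low_grid n A : nat :=
  count (fun j => `|hfun A (grid n j)| <= 1) (iota 0 n.+1).

Lemma half_zeros_le n A (s : seq R) : (m < n)%N -> uniq s ->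
  (forall x, x \in s -> 0 <= x <= pi /\ outcome_poly n A x = 0) ->
  (size s <= ((m.*2).+4.*2 + low_grid n A).*2.+1)%N.
Proof.
move=> mn us sP; rewrite -(size_sort <=%R).
have sh x : x \in sort <=%R s -> 0 <= x <= pi /\ hfun A x = sin ((n%:R + 2^-1) * x).
  rewrite mem_sort => /sP[xpi f0]; split=> //.
  by apply/eqP; rewrite eq_sym -subr_eq0 -outcome_poly_sin f0 mulr0.
have [||t [st tP ts]] := @sorted_breakpoints R (fun c => 0 <= c <= pi /\
    [\/ (level_poly A).[cos c] = 0, (tangency_poly n A).[cos c] = 0 |
        exists j, [/\ (j <= n)%N, c = grid n j & `|hfun A c| <= 1]]) (sort <=%R s).
- by rewrite sort_lt_sorted.
- move=> a b /sh[/andP[a0 _] ha] /sh[/andP[_ bpi] hb] ab.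
  have [c cab cP] := breakpoint a0 ab bpi ha hb.
  exists c => //; split=> //; move: cab => /andP[ac cb].
  by rewrite (le_trans a0) // (le_trans cb).
apply: leq_trans ts _; rewrite ltnS leq_double.
have ut : uniq t by apply: sorted_uniq st; [exact: lt_trans | exact: ltxx].
pose p1 (c : R) := (level_poly A).[cos c] == 0.
pose p2 (c : R) := (tangency_poly n A).[cos c] == 0.
have S1 : (count p1 t <= (m.*2).+4)%N.
  rewrite -size_filter; apply/ltnW; apply: leq_trans (size_level A).
  apply: cos_poly_roots; [exact: level_neq0 | exact: filter_uniq | move=> x].
  by rewrite mem_filter => /andP[/eqP -> /tP[[]]].
have S2 : (count p2 t <= (m.*2).+4)%N.
  rewrite -size_filter; apply/ltnW; apply: leq_trans (size_tangency n A).
  apply: cos_poly_roots; [exact: tangency_neq0 | exact: filter_uniq | move=> x].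
  by rewrite mem_filter => /andP[/eqP -> /tP[[]]].
have S3 : (count (predC (predU p1 p2)) t <= low_grid n A)%N.
  rewrite -size_filter /low_grid -size_filter -(size_map (grid n)).
  apply: uniq_leq_size; first exact: filter_uniq.
  move=> c; rewrite mem_filter => /andP[]; rewrite [X in X -> _]/= negb_or => /andP[/eqP n1 /eqP n2].
  move=> /tP[[_ []]] // [j [jn cE hc]] _.
  by rewrite cE; apply: map_f; rewrite mem_filter -cE hc mem_iota.
rewrite -(count_predC (predU p1 p2)) leq_add // -addnn.
apply: leq_trans (leq_add S1 S2).
by rewrite -count_predUI leq_addr.
Qed.

Lemma Z_le_low_grid n A : (m < n)%N ->
  (Z (@outcome_poly R m n A) <= ((m.*2).+4.*2 + low_grid n A).*2.+1.*2)%N.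
Proof.
move=> mn; apply: Z_le => s us sP; apply: uniq_half_zeros us sP.
  exact: outcome_poly_sym.
by move=> {}s us sP; exact: half_zeros_le.
Qed.

End ZeroUpper.

(** * The LYM inequality and central binomial coefficients *)

Section Sperner.
Context {I : finType}.
Implicit Types (U s t : {set I}) (F : {set {set I}}).

(** Induction on the size of the ground set U. An antichain that contains U is
reduced to U. Otherwise each s misses some i in U, and 1 / C(u, |s|) is the
average over the u elements i of U of 1 / C(u - 1, |s|) restricted to the i
outside s; the inductive hypothesis applies to the members avoiding i. *)
Lemma lym (R : realType) F U : (forall s, s \in F -> s \subset U) ->
  (forall s t, s \in F -> t \in F -> s \subset t -> s = t) ->
  \sum_(s in F) ('C(#|U|, #|s|)%:R : R)^-1 <= 1.
Proof.
have [n] := ubnP #|U|; elim: n U F => // n IH U F /ltnSE Un FU anti.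
have [UF|UF] := boolP (U \in F).
  have -> : F = [set U]%SET.
    apply/setP => s; rewrite inE; apply/idP/eqP => [sF|-> //].
    exact: anti (FU _ sF).
  by rewrite big_set1 binn invr1.
have sU s : s \in F -> (#|s| < #|U|)%N.
  move=> sF; apply: proper_card; rewrite finset.properEneq FU // andbT.
  by apply: contraNneq UF => <-.
have [U0|U0] := posnP #|U|.
  rewrite big_pred0 // => s; apply: contraTF (isT) => /sU.
  by rewrite U0 ltn0.
have step s : s \in F -> ('C(#|U|, #|s|)%:R : R)^-1 =
    #|U|%:R^-1 * \sum_(i in U | i \notin s) ('C(#|U|.-1, #|s|)%:R)^-1.
  move=> sF; have sn := sU s sF.
  rewrite big_const iter_addr_0.
  have -> : #|[pred i in U | i \notin s]| = (#|U| - #|s|)%N.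
    by rewrite -cardsDS ?FU //; apply: eq_card => i; rewrite !inE andbC.
  have b0 : 'C(#|U|.-1, #|s|)%:R != 0 :> R.
    by rewrite pnatr_eq0 -lt0n bin_gt0 -ltnS prednK.
  have B0 : 'C(#|U|, #|s|)%:R != 0 :> R.
    by rewrite pnatr_eq0 -lt0n bin_gt0 ltnW.
  have u0 : #|U|%:R != 0 :> R by rewrite pnatr_eq0 -lt0n.
  have /(congr1 (fun k => k%:R : R)) := mul_bin_down #|U| #|s|.
  rewrite !natrM => e.
  rewrite -[_ *+ (_ - _)]mulr_natl; apply: (mulfI (mulf_neq0 (mulf_neq0 u0 b0) B0)).
  transitivity (#|U|%:R * 'C(#|U|.-1, #|s|)%:R : R); first by field; rewrite B0.
  by rewrite [LHS]e; field; rewrite u0 b0.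
rewrite (eq_bigr _ step) -mulr_sumr.
rewrite (exchange_big_dep (mem U)) /=; last by move=> s i _ /andP[].
rewrite ler_pdivrMl ?ltr0n // mulr1 -sumr_const; apply: ler_sum => i iU.
have cU : #|U :\ i| = #|U|.-1 by rewrite (cardsD1 i U) iU.
rewrite -cU.
apply: le_trans (IH (U :\ i) [set s in F | i \notin s]%SET _ _ _).
- rewrite le_eqVlt; apply/orP; left; apply/eqP; apply: eq_bigl => s.
  by rewrite inE iU.
- by rewrite cU; move: U0 Un; case: #|U|.
- move=> s; rewrite inE => /andP[sF si]; rewrite subsetD1 si andbT; exact: FU.
- by move=> s t; rewrite !inE => /andP[sF _] /andP[tF _]; exact: anti.
Qed.

End Sperner.

Lemma bin_le_half n k : ('C(n, k) <= 'C(n, n./2))%N.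
Proof.
have low d : (d <= n./2)%N -> ('C(n, n./2 - d) <= 'C(n, n./2))%N.
  elim: d => [|d IH] dn; first by rewrite subn0.
  apply: leq_trans (IH (ltnW dn)).
  have -> : (n./2 - d = (n./2 - d.+1).+1)%N by lia.
  set j := (n./2 - d.+1)%N.
  have jn : (j.+1 <= n - j)%N by rewrite /j; have := odd_double_half n; lia.
  by have := mul_bin_left n j; nia.
have [kn|kn] := leqP k n./2.
  by rewrite -(subKn kn); apply: low; exact: leq_subr.
have [kn'|kn'] := leqP k n; last by rewrite bin_small.
rewrite -bin_sub // -(@subKn (n - k) n./2); last by have := odd_double_half n; lia.
by apply: low; exact: leq_subr.
Qed.

(** Integer form of C(2j, j) <= 4^j / sqrt (2j + 1), by induction from
C(2j+2, j+1) (j+1) = 2 (2j+1) C(2j, j). *)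
Lemma central_bin j : ('C(j.*2, j) ^ 2 * j.*2.+1 <= 16 ^ j)%N.
Proof.
elim: j => // j IH.
have e : ('C(j.*2.+2, j.+1) * j.+1 = 'C(j.*2, j) * (2 * j.*2.+1))%N.
  have h1 := mul_bin_diag j.*2.+2 j; have h2 := mul_bin_down j.*2.+1 j.
  by rewrite /= (_ : j.*2.+1 - j = j.+1)%N in h1 h2 *; nia.
rewrite doubleS [(16 ^ j.+1)%N]expnS; set B := 'C(j.*2.+2, j.+1) in e *; set b := 'C(j.*2, j) in e IH.
have : (B ^ 2 * j.*2.+3 * j.+1 ^ 2 <= 16 * 16 ^ j * j.+1 ^ 2)%N.
  have -> : (B ^ 2 * j.*2.+3 * j.+1 ^ 2 = (B * j.+1) ^ 2 * j.*2.+3)%N by nia.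
  rewrite e.
  have -> : ((b * (2 * j.*2.+1)) ^ 2 * j.*2.+3 = (b ^ 2 * j.*2.+1) * (4 * j.*2.+1 * j.*2.+3))%N by nia.
  apply: (@leq_trans (16 ^ j * (4 * j.*2.+1 * j.*2.+3))%N); first by rewrite leq_mul2r IH orbT.
  by rewrite (mulnC 16%N) -[leqRHS]mulnA leq_mul2l; apply/orP; right; nia.
by rewrite leq_mul2r expn_eq0.
Qed.

Lemma bin_sqr_le n k : ('C(n, k) ^ 2 * n.+1 <= 4 ^ n)%N.
Proof.
apply: (@leq_trans ('C(n, n./2) ^ 2 * n.+1)%N).
  by rewrite leq_mul2r leq_exp2r // bin_le_half orbT.
have := odd_double_half n; set j := n./2; case: (odd n) => /= <-.
  rewrite add1n; have := central_bin j.+1.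
  have -> : 'C(j.+1.*2, j.+1) = (2 * 'C(j.*2.+1, j))%N.
    rewrite doubleS binS -(@bin_sub j.*2.+1 j.+1); last by lia.
    by rewrite (_ : j.*2.+1 - j.+1 = j)%N; lia.
  have -> : (16 ^ j.+1 = 4 * 4 ^ j.*2.+1)%N.
    by rewrite (_ : 16 = 4 ^ 2)%N // -expnM -expnS; congr (4 ^ _)%N; lia.
  by rewrite doubleS; nia.
rewrite add0n; apply: leq_trans (central_bin j) _.
by rewrite (_ : 16 = 4 ^ 2)%N // -expnM; apply: leq_pexp2l => //; lia.
Qed.

(** * The Littlewood-Offord inequality *)

Section LittlewoodOfford.
Context {R : realType} {I : finType}.
Implicit Types (A G : {set I}) (a : I -> R).

Lemma antichain_card (F : {set {set I}}) G :
  (forall s, s \in F -> s \subset G) ->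
  (forall s t, s \in F -> t \in F -> s \subset t -> s = t) ->
  #|F|%:R <= 2 ^+ #|G| / Num.sqrt #|G|.+1%:R :> R.
Proof.
move=> FG anti; set B := _ / _.
have B0 : 0 < B by rewrite divr_gt0 ?exprn_gt0 // sqrtr_gt0 ltr0n.
have := lym R FG anti; rewrite -[X in _ <= X -> _](divff (lt0r_neq0 B0)).
rewrite ler_pdivlMr // mulr_suml; apply: le_trans.
rewrite -sumr_const; apply: ler_sum => s sF.
have b0 : 0 < ('C(#|G|, #|s|)%:R : R).
  by rewrite ltr0n bin_gt0 subset_leq_card // FG.
rewrite mulrC ler_pdivlMr // mul1r.
rewrite -(@ler_pXn2r _ 2) ?nnegrE ?(ltW B0) ?(ltW b0) //.
rewrite /B expr_div_n sqr_sqrtr ?ler0n // ler_pdivlMr ?ltr0n //.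
rewrite -exprM mulnC exprM -!natrX -natrM ler_nat.
exact: bin_sqr_le.
Qed.

Lemma card_sets : #|{set I}|%:R = 2 ^+ #|I| :> R.
Proof. by rewrite -[#|{set I}|]cardsT -powersetT card_powerset cardsT natrX. Qed.

(** Fix the part of A outside G. Replacing A by its symmetric difference with
the indices of negative coefficients makes the remaining sum one of |a_k|,
which increases by at least delta when an element is added. The sets whose sum
lies in a window of length delta are thus an antichain in G. *)
Lemma littlewood_offord G a (delta c : R) :
  (forall k, k \in G -> delta <= `|a k|) -> 0 < delta ->
  prb (fun A => c <= \sum_(k in A) a k < c + delta) <= (Num.sqrt #|G|.+1%:R)^-1 :> R.
Proof.
move=> aG d0; set p := fun A : {set I} => _.
(* The part of A in G, with the indices of negative coefficients flipped. *)
pose phi A := [set k in G | (k \in A) (+) (a k < 0)]%SET.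
have sumE A : \sum_(k in A) a k =
    \sum_(k in A :\: G) a k + (\sum_(k in phi A) `|a k| + \sum_(k in G | a k < 0) a k).
  rewrite [LHS](bigID (mem G)) /= addrC; congr (_ + _).
    by apply: eq_bigl => k; rewrite !inE andbC.
  rewrite [X in _ = X + _](_ : _ =
     \sum_(k in G) (if (k \in A) (+) (a k < 0) then `|a k| else 0)); last first.
    by rewrite -big_mkcondr; apply: eq_bigl => k; rewrite !inE.
  rewrite [X in _ = _ + X]big_mkcondr -big_split /=.
  rewrite (eq_bigl (fun k => (k \in G) && (k \in A))); last by move=> k; rewrite andbC.
  rewrite big_mkcondr; apply: eq_bigr => k _.
  case: (ltrP (a k) 0) => h; case: (k \in A) => /=; rewrite ?add0r ?addr0 //.
    by rewrite ltr0_norm // addNr.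
  by rewrite ger0_norm.
rewrite prb_card card_sets.
have -> : #|p| = (\sum_(B in powerset (~: G)) #|[set A | p A & A :\: G == B]%SET|)%N.
  rewrite -sum1_card (partition_big (fun A => A :\: G) (mem (powerset (~: G)))) /=.
    by apply: eq_bigr => B _; rewrite -sum1_card; apply: eq_bigl => A; rewrite inE.
  by move=> A _; rewrite powersetE; apply/fintype.subsetP => k; rewrite !inE => /andP[].
have bnd B : #|[set A | p A & A :\: G == B]%SET|%:R <= 2 ^+ #|G| / Num.sqrt #|G|.+1%:R :> R.
  set FB := [set A | _ & _]%SET.
  have phiI : {in FB &, injective phi}.
    move=> A1 A2; rewrite !inE => /andP[_ /eqP e1] /andP[_ /eqP e2] /setP e.
    have e3 : A1 :\: G = A2 :\: G by rewrite e1.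
    apply/setP => k; have := e k; have := congr1 (fun X : {set I} => k \in X) e3.
    by rewrite !inE; case: (k \in G) => //= _ /addIb.
  rewrite -(card_in_imset phiI); apply: antichain_card.
    by move=> _ /imsetP[A _ ->]; apply/fintype.subsetP => k; rewrite inE => /andP[].
  move=> _ _ /imsetP[A1 A1F ->] /imsetP[A2 A2F ->] s12.
  apply/eqP; rewrite finset.eqEsubset s12 /=; apply/fintype.subsetP => k k2.
  apply/negPn/negP => k1.
  move: A1F A2F; rewrite !inE => /andP[/andP[c1 _] /eqP e1] /andP[/andP[_ c2] /eqP e2].
  have kG : k \in G by move: k2; rewrite inE => /andP[].
  have : \sum_(j in phi A1) `|a j| + delta <= \sum_(j in phi A2) `|a j|.
    rewrite [leRHS](bigID (mem (phi A1))) /=; apply: lerD.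
      rewrite [leLHS](eq_bigl (fun i => (i \in phi A2) && (i \in phi A1))) // => i.
      by case: (boolP (i \in phi A1)) => [/(fintype.subsetP s12) ->|_]; rewrite ?andbF.
    rewrite (bigD1 k) /=; last by rewrite k2.
    by apply: ler_wpDr; [apply: sumr_ge0 | exact: aG].
  by move: c1 c2; rewrite (sumE A1) (sumE A2) e1 e2; lra.
rewrite natr_sum; apply: (@le_trans _ _ ((2 ^+ #|~: G| * (2 ^+ #|G| / Num.sqrt #|G|.+1%:R)) / 2 ^+ #|I|)).
  rewrite ler_pM2r ?invr_gt0 ?exprn_gt0 //.
  apply: le_trans (ler_sum _ (fun B _ => bnd B)) _.
  by rewrite sumr_const card_powerset -[leLHS]mulr_natl natrX.
by rewrite mulrA -exprD addnC cardsC mulrAC divff ?mul1r // expf_neq0.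
Qed.

Lemma littlewood_offord_itv G a (delta c L : R) :
  (forall k, k \in G -> delta <= `|a k|) -> 0 < delta -> 0 <= L ->
  prb (fun A => c <= \sum_(k in A) a k <= c + L) <=
    (L / delta + 1) / Num.sqrt #|G|.+1%:R :> R.
Proof.
move=> aG d0 L0; pose K := (Num.truncn (L / delta)).+1.
have /andP[K1 K2] := truncn_itv (divr_ge0 L0 (ltW d0)).
apply: (@le_trans _ _ (\sum_(i < K) prb (fun A =>
    c + i%:R * delta <= \sum_(k in A) a k < c + i%:R * delta + delta))).
  rewrite -avg_sum; apply: ler_avg => A; case: andP => [[h1 h2]|_]; last first.
    by apply: sumr_ge0 => i _; exact: ler0n.
  set S := \sum_(k in A) a k in h1 h2 *.
  have S0 : 0 <= (S - c) / delta by rewrite divr_ge0 ?subr_ge0 // ltW.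
  have /andP[t1 t2] := truncn_itv S0.
  set t := Num.truncn ((S - c) / delta) in t1 t2.
  have tK : (t < K)%N.
    rewrite ltnS; apply: le_truncn; rewrite ler_pM2r ?invr_gt0 //; lra.
  rewrite (bigD1 (Ordinal tK)) //= -[leLHS]addr0; apply: lerD; last first.
    by apply: sumr_ge0 => i _; exact: ler0n.
  rewrite ler_pdivlMr // in t1; rewrite ltr_pdivrMr // -natr1 in t2.
  rewrite ler_nat lt0b; apply/andP; split; lra.
apply: (@le_trans _ _ (\sum_(i < K) (Num.sqrt #|G|.+1%:R)^-1)).
  by apply: ler_sum => i _; exact: littlewood_offord.
rewrite sumr_const card_ord -[leLHS]mulr_natl ler_pM2r ?invr_gt0 ?sqrtr_gt0 ?ltr0n //.
by rewrite /K -natr1 lerD2r.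
Qed.

End LittlewoodOfford.

(** * Upper bound for the probability of a low value of h *)

Section LevelProbability.
Context {R : realType} {m : nat}.

(** If |cos (k y)| < 1/2 then cos (2 k y) = 2 cos (k y)^2 - 1 < -1/2. The
index k for k odd, or else 2 k, is therefore good, and these choices are
distinct because k is odd. *)
Lemma card_large_cos (y : R) :
  ((m + 2) %/ 4 <= #|[set k : 'I_m.+1 | (2^-1 <= `|cos (k%:R * y)|)%R]%SET|)%N.
Proof.
pose good k : bool := 2^-1 <= `|cos (k%:R * y : R)|.
have good2 k : ~~ good k -> good (k.*2).
  rewrite /good -ltNge cos_double_nat => h.
  have : cos (k%:R * y) ^+ 2 <= 4^-1.
    by rewrite -real_normK ?num_real //; have := normr_ge0 (cos (k%:R * y)); nra.
  by rewrite ler_normr => ?; apply/orP; right; lra.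
pose f (i : 'I_((m + 2) %/ 4)) : 'I_m.+1 :=
  inord (if good (i.*2.+1)%N then i.*2.+1 else (i.*2.+1).*2).
have fE i : f i = (if good (i.*2.+1)%N then i.*2.+1 else (i.*2.+1).*2) :> nat.
  by rewrite /f inordK //; have := ltn_ord i; case: ifP => _; lia.
have fI : injective f.
  move=> i j /(congr1 val) /=; rewrite !fE => h; apply: val_inj => /=.
  by move: h; do 2 case: ifP => _; lia.
rewrite -[leqLHS]card_ord -cardsT -(card_imset _ fI); apply: subset_leq_card.
apply/fintype.subsetP => _ /imsetP[i _ ->]; rewrite inE fE.
by case: ifPn => // /good2.
Qed.

(** The event says that S lies in an interval of length 1 / sin (y/2), which is
at least 1. *)
Lemma prb_low_le (y : R) : (0 < m)%N -> 0 < y <= pi ->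
  prb (fun A : {set 'I_m.+1} => `|hfun A y| <= 1) <=
    6 / (Num.sqrt m%:R * sin (y / 2)).
Proof.
move=> m0 /andP[y0 ypi]; set s := sin (y / 2).
have s0 : 0 < s by apply: sin_gt0_pi; have := pi_gt0 R; lra.
have s1 : s <= 1 by exact: sin_le1.
have l1 : 1 <= s^-1 by rewrite -invr1 lef_pV2 ?posrE.
set G := [set k : 'I_m.+1 | 2^-1 <= `|cos (k%:R * y : R)|]%SET.
apply: (@le_trans _ _ (prb (fun A : {set 'I_m.+1} =>
    (1 - s^-1) / 2 <= \sum_(k in A) cos (k%:R * y) <= (1 - s^-1) / 2 + s^-1))).
  apply: ler_prb => A; rewrite /hfun -/s ler_norml => /andP[h1 h2].
  have : - s^-1 <= 2 * csum A y - 1 <= s^-1.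
    by rewrite -(ler_pM2l s0) -[X in _ && X](ler_pM2l s0) mulrN divff ?gt_eqF // h1.
  by rewrite /csum => /andP[h3 h4]; apply/andP; split; lra.
apply: le_trans (@littlewood_offord_itv _ _ G (fun k => cos (k%:R * y)) 2^-1
  ((1 - s^-1) / 2) s^-1 _ _ _) _.
- by move=> k; rewrite inE.
- by rewrite invr_gt0.
- by rewrite invr_ge0 ltW.
have G1 : m%:R / 4 <= #|G|.+1%:R :> R.
  rewrite ler_pdivrMr // -natrM ler_nat.
  by have := card_large_cos y; rewrite -/G; lia.
have m0' : 0 < Num.sqrt m%:R :> R by rewrite sqrtr_gt0 ltr0n.
have sq : Num.sqrt m%:R / 2 <= Num.sqrt #|G|.+1%:R :> R.
  rewrite -(@ler_pXn2r _ 2) ?nnegrE ?divr_ge0 ?sqrtr_ge0 //.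
  rewrite expr_div_n !sqr_sqrtr ?ler0n // (_ : 2 ^+ 2 = 4 :> R) //; ring.
apply: (@le_trans _ _ ((3 * s^-1) / (Num.sqrt m%:R / 2))).
  apply: ler_pM; rewrite ?invr_ge0 ?sqrtr_ge0 //; first 1 last.
  - by rewrite invrK; lra.
  - by rewrite lef_pV2 // posrE ?divr_gt0 // sqrtr_gt0 ltr0n.
  - by rewrite invrK; lra.
rewrite le_eqVlt; apply/orP; left; apply/eqP; field.
by rewrite !gt_eqF.
Qed.

End LevelProbability.

(** * Lower bound for the probability of a low value of h *)

Section SmallBall.
Context {R : realType}.

(** By Markov, with probability at least 3/4 the variable u falls in one of 2K
bins of length l around 0, and by Cauchy-Schwarz two independent copies share
a bin with probability at least (3/4)^2 / (2K). *)
Lemma collision (T : finType) (u : T -> R) (sigma l : R) (K : nat) :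
  (0 < #|T|)%N -> 0 <= sigma -> 0 < l -> (0 < K)%N -> 2 * sigma <= K%:R * l ->
  avg (fun t => u t ^+ 2) <= sigma ^+ 2 ->
  9 / (32 * K%:R) <= avg (fun t => prb (fun t' => `|u t - u t'| <= l)) :> R.
Proof.
move=> T0 s0 l0 K0 Kl us.
have k0 : 0 < K%:R :> R by rewrite ltr0n.
pose good t := `|u t| < K%:R * l.
pose idx t := Num.truncn (u t / l + K%:R).
pose b i t := good t && (idx t == i).
have idxP t : good t -> (idx t)%:R <= u t / l + K%:R < (idx t).+1%:R /\ (idx t < K + K)%N.
  rewrite /good ltr_norml -mulNr => /andP[h1 h2].
  have h : 0 <= u t / l + K%:R.
    by rewrite -lerBlDr sub0r ler_pdivlMr // ltW.
  split; first exact: truncn_itv.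
  by rewrite truncn_lt_nat // natrD ltrD2r ltr_pdivrMr.
have sumb t : \sum_(i < K + K) (b i t)%:R = (good t)%:R :> R.
  have [gt|/negPf gt] := boolP (good t); last first.
    by rewrite big1 // => i _; rewrite /b gt.
  rewrite (bigD1 (Ordinal (idxP t gt).2)) //= big1; last first.
    move=> i; rewrite -val_eqE /= eq_sym => /negPf it.
    by rewrite /b it andbF.
  by rewrite /b gt eqxx addr0.
have hgood : 3 / 4 <= prb good :> R.
  have : prb (fun t => ~~ good t) <= 4^-1 :> R.
    have h := @markov_avg R T (fun t => u t ^+ 2) ((K%:R * l) ^+ 2) _ _.
    apply: (@le_trans _ _ (avg (fun t => u t ^+ 2) / (K%:R * l) ^+ 2)).
      apply: le_trans (h _ _); last 2 first.
      - by rewrite exprn_gt0 // mulr_gt0.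
      - by move=> t; exact: sqr_ge0.
      apply: ler_prb => t; rewrite /good -leNgt => gt.
      by rewrite -[leRHS]real_normK ?num_real // ler_pXn2r ?nnegrE // ltW ?mulr_gt0.
    rewrite ler_pdivrMr ?exprn_gt0 ?mulr_gt0 //; apply: le_trans us _.
    have : 0 <= K%:R * l by rewrite ltW // mulr_gt0.
    nra.
  by have := @prb_compl R T good T0; lra.
apply: (@le_trans _ _ (\sum_(i < K + K) prb (b i) ^+ 2)).
  (* The linear lower bound p^2 >= 2 lam p - lam^2 replaces Cauchy-Schwarz; this
     lam is the mean of p over the bins when the p sum to 3/4. *)
  pose lam : R := 3 / (8 * K%:R).
  have lam0 : 0 <= lam by rewrite divr_ge0 // mulr_ge0 // ltW.
  apply: (@le_trans _ _ (\sum_(i < K + K) (2 * lam * prb (b i) - lam ^+ 2))).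
    rewrite sumrB sumr_const card_ord -mulr_sumr -avg_sum.
    rewrite (_ : avg _ = prb good); last exact: eq_avg.
    have h : 2 * lam * (3 / 4) <= 2 * lam * prb good.
      by rewrite ler_wpM2l // mulr_ge0.
    have e : lam ^+ 2 *+ (K + K) = 9 / (32 * K%:R).
      by rewrite -[LHS]mulr_natr natrD /lam; field; rewrite gt_eqF.
    have e' : 2 * lam * (3 / 4) = 9 / (32 * K%:R) + 9 / (32 * K%:R).
      by rewrite /lam; field; rewrite gt_eqF.
    by rewrite e; move: h; rewrite e' /prb; lra.
  apply: ler_sum => i _; have := sqr_ge0 (prb (b i) - lam); nra.
have -> : \sum_(i < K + K) prb (b i) ^+ 2 =
    avg (fun t => avg (fun t' => \sum_(i < K + K) (b i t)%:R * (b i t')%:R)) :> R.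
  rewrite -[RHS](@eq_avg _ _ (fun t => \sum_(i < K + K) (b i t)%:R * prb (b i))).
    rewrite avg_sum; apply: eq_bigr => i _.
    rewrite expr2 /prb -avgZ; apply: eq_avg => t; by rewrite mulrC.
  by move=> t; rewrite avg_sum; apply: eq_bigr => i _; rewrite avgZ.
apply: ler_avg => t; apply: ler_avg => t'.
have [gt|/negPf gt] := boolP (good t); last first.
  by rewrite big1 // => i _; rewrite /b gt mul0r.
have [gt'|/negPf gt'] := boolP (good t'); last first.
  by rewrite big1 // => i _; rewrite /b gt' mulr0.
have [/andP[i1 i2] il] := idxP t gt; have [/andP[j1 j2] jl] := idxP t' gt'.
rewrite (bigD1 (Ordinal il)) //= big1; last first.
  move=> i; rewrite -val_eqE /= eq_sym => /negPf it.
  by rewrite /b it andbF mul0r.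
rewrite /b gt gt' eqxx /= addr0 mul1r ler_nat; case: eqP => //= e; rewrite lt0b.
rewrite e in j1 j2; rewrite -natr1 in i2 j2.
have : `|u t / l - u t' / l| <= 1 by rewrite ler_norml; apply/andP; split; lra.
by rewrite -mulrBl normrM normfV (ger0_norm (ltW l0)) ler_pdivrMr // mul1r.
Qed.

Context {m : nat}.
Local Notation idx := (index_enum 'I_m.+1).

(** The even indices whose successor is also an index; when m is even, the last
index is left unpaired. *)
Definition evens : {set 'I_m.+1} := [set k : 'I_m.+1 | ~~ odd k && (k < m)%N]%SET.

(** The involution exchanging 2p and 2p + 1; it fixes the last index when m is
even. *)
Definition mate (k : 'I_m.+1) : 'I_m.+1 :=
  inord (if odd k then k.-1 else if (k < m)%N then k.+1 else k).

Lemma mateE k : mate k = (if odd k then k.-1 else if (k < m)%N then k.+1 else k) :> nat.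
Proof. by rewrite inordK //; have := ltn_ord k; case: ifP => _; [|case: ifP]; lia. Qed.

Lemma mateK : involutive mate.
Proof.
move=> k; apply: val_inj; rewrite /= mateE; have := mateE k; have := ltn_ord k.
by move: (nat_of_ord (mate k)) (nat_of_ord k) => t i; do 4?case: ifP; lia.
Qed.

Lemma mate_evens k : (mate k \in evens) = odd k.
Proof.
rewrite inE mateE; have := ltn_ord k; move: (nat_of_ord k) => i.
by do 2?case: ifP; lia.
Qed.

Definition signed_sum (y : R) (A : {set 'I_m.+1}) : R :=
  rad idx (fun k => cos (k%:R * y)) A.

Variables (y : R).
Let a (k : nat) : R := cos (k%:R * y).
Definition even_coef (k : 'I_m.+1) : R := if k \in evens then a k else 0.
(** The odd-indexed signs, given the coefficients of their even mates, so that
the odd half has exactly the law of the even half. *)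
Definition odd_coef (k : 'I_m.+1) : R := if odd k then a k.-1 else 0.

Lemma rad_mate (A : {set 'I_m.+1}) :
  rad idx odd_coef A = rad idx even_coef (mate @^-1: A).
Proof.
rewrite /rad [RHS](reindex mate) /=; last exact/onW_bij/inv_bij/mateK.
apply: eq_bigr => k _; rewrite /even_coef mate_evens /odd_coef.
case: ifP => ok; last by rewrite !mul0r.
by rewrite mateE ok /rsgn inE mateK.
Qed.

(** The even half and the modified odd half are independent, and the second is
distributed as minus the first by symmetry; their sum is small exactly when
two independent copies of the even half collide. *)
Lemma small_ball_pairs (l : R) (K : nat) : 0 < l -> (0 < K)%N ->
  2 * Num.sqrt m.+1%:R <= K%:R * l ->
  9 / (32 * K%:R) <=
    prb (fun A : {set 'I_m.+1} => `|rad idx even_coef A + rad idx odd_coef A| <= l) :> R.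
Proof.
move=> l0 K0 Kl.
have := @collision {set 'I_m.+1} (rad idx even_coef) (Num.sqrt m.+1%:R) l K
  (card_sets_gt0) (sqrtr_ge0 _) l0 K0 Kl.
have -> : (avg (fun t => rad idx even_coef t ^+ 2) <= Num.sqrt m.+1%:R ^+ 2).
  rewrite avg_rad2 ?index_enum_uniq // sqr_sqrtr ?ler0n //.
  apply: (@le_trans _ _ (\sum_(k <- idx) 1)); last first.
    by rewrite -[leLHS]/(\sum_(k : 'I_m.+1) 1) sumr_const card_ord.
  apply: ler_sum => k _; rewrite /even_coef; case: ifP => _.
    by rewrite /a; have := cos2Dsin2 (k%:R * y); have := sqr_ge0 (sin (k%:R * y)); lra.
  by rewrite expr0n.
move=> /(_ isT); congr (_ <= _).
transitivity (avg (fun A : {set 'I_m.+1} => avg (fun B : {set 'I_m.+1} =>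
   (`|rad idx even_coef A + rad idx odd_coef B| <= l)%R%:R : R))).
  apply: eq_avg => A; rewrite /prb.
  rewrite -[LHS](@avg_reindex _ _ (fun B : {set 'I_m.+1} => mate @^-1: (~: B))).
    apply: eq_avg => B /=; rewrite rad_mate preimsetC radC opprK.
    by [].
  exists (fun B : {set 'I_m.+1} => mate @^-1: (~: B)) => B;
    by apply/setP => k; rewrite !inE mateK negbK.
symmetry; transitivity (avg (fun A : {set 'I_m.+1} => avg (fun B : {set 'I_m.+1} =>
   (`|rad idx even_coef A + rad idx odd_coef A| <= l)%R%:R : R))).
  by apply: eq_avg => A; rewrite avg_cst // card_sets_gt0.
rewrite (avg_mix evens); apply: eq_avg => A; apply: eq_avg => B.
congr ((`|_ + _| <= _)%R%:R); apply: eq_bigr => k _.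
  rewrite /even_coef; case: ifP => ke; last by rewrite !mul0r.
  by rewrite /rsgn /mixset finset.in_setU finset.in_setI finset.in_setD ke andbT orbF.
rewrite /odd_coef; case: ifP => ok; last by rewrite !mul0r.
have ke : k \in evens = false by rewrite inE ok.
by rewrite /rsgn /mixset finset.in_setU finset.in_setI finset.in_setD ke andbF.
Qed.

(** The error made by giving odd indices their mates' coefficients is a
Rademacher sum with coefficients at most y, apart from a single unpaired one at
most 1, and Chebyshev's inequality controls it. *)
Lemma small_ball (l : R) (K : nat) : 0 < l -> (0 < K)%N ->
  2 * Num.sqrt m.+1%:R <= K%:R * l ->
  9 / (32 * K%:R) - (m.+1%:R * y ^+ 2 + 1) / l ^+ 2 <=
    prb (fun A : {set 'I_m.+1} => `|signed_sum y A| <= 2 * l) :> R.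
Proof.
move=> l0 K0 Kl; have h := small_ball_pairs l0 K0 Kl.
pose e (k : 'I_m.+1) : R := a k - even_coef k - odd_coef k.
have radE A : signed_sum y A =
    rad idx even_coef A + rad idx odd_coef A + rad idx e A.
  rewrite /signed_sum /rad -!big_split /=; apply: eq_bigr => k _; rewrite /e /a; ring.
have he : prb (fun A => l < `|rad idx e A|) <= (m.+1%:R * y ^+ 2 + 1) / l ^+ 2.
  apply: le_trans (chebyshev_rad _ _ l0) _; first exact: index_enum_uniq.
  rewrite ler_pM2r ?invr_gt0 ?exprn_gt0 //.
  apply: (@le_trans _ _ (\sum_(k : 'I_m.+1) (y ^+ 2 + (k == ord_max)%:R))).
    apply: ler_sum => k _; rewrite /e /even_coef /odd_coef inE.
    have [ok|ok] /= := boolP (odd k).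
      rewrite subr0; apply: (@le_trans _ _ (y ^+ 2)); last by rewrite lerDl.
      have k0 : (0 < k)%N by case: (nat_of_ord k) ok.
      rewrite -[leLHS]real_normK ?num_real // -[leRHS]real_normK ?num_real //.
      rewrite ler_pXn2r ?nnegrE // -[in a k](prednK k0); exact: cos_step.
    rewrite subr0; case: ifPn => km.
      by rewrite subrr expr0n addr_ge0 ?sqr_ge0.
    have -> : k = ord_max by apply: val_inj => /=; have := ltn_ord k; lia.
    rewrite eqxx subr0 /a /=.
    have := cos2Dsin2 (m%:R * y); have := sqr_ge0 (sin (m%:R * y)).
    have := sqr_ge0 y; lra.
  rewrite big_split /= sumr_const card_ord -[X in X + _]mulr_natl lerD2l.
  rewrite (bigD1 ord_max) //= eqxx big1 ?addr0 // => k /negPf -> //.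
rewrite lerBlDr; apply: le_trans h _; apply: le_trans (lerD (lexx _) he).
apply: prb_cap => A; rewrite radE => h1; apply: contraNT; rewrite -leNgt => h2.
by apply: le_trans (ler_normD _ _) _; lra.
Qed.

Lemma signed_sumE A : signed_sum y A = 2 * csum A y - dir m y.
Proof.
rewrite /dir big_mkord /csum big_mkcond /= mulr_sumr -sumrB.
apply: eq_bigr => k _; rewrite /rsgn; case: ifP => _; ring.
Qed.

(** Since h = sin (y/2) X + (sin ((m + 1/2) y) - sin (y/2)) / 2, the nonrandom
part is below 3/4 and it is enough that |X| <= 1 / (2 y). This centred event
is used because X, unlike S, is symmetric. *)
Lemma prb_low_ge_rad : 0 < y -> y < 1 ->
  prb (fun A : {set 'I_m.+1} => `|signed_sum y A| <= 2 * (4 * y)^-1) <=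
  prb (fun A : {set 'I_m.+1} => `|hfun A y| < 1) :> R.
Proof.
move=> y0 y1; apply: ler_prb => A; rewrite signed_sumE.
set X := 2 * csum A y - dir m y => hX.
have s2 : sin (y / 2) <= y / 2 by apply: sin_le_id; lra.
have s0 : 0 < sin (y / 2) by apply: sin_gt0_pi; have := pi_ge2 R; lra.
have -> : hfun A y = sin (y / 2) * X + (sin ((m%:R + 2^-1) * y) - sin (y / 2)) / 2.
  rewrite /hfun /X; have := dirichletE m y; lra.
have hs : `|sin (y / 2) * X| <= 4^-1.
  rewrite normrM gtr0_norm //.
  apply: (@le_trans _ _ ((y / 2) * (2 * (4 * y)^-1))).
    by apply: ler_pM => //; exact: ltW.
  by rewrite le_eqVlt; apply/orP; left; apply/eqP; field; rewrite gt_eqF.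
have := sin_max ((m%:R + 2^-1) * y); move: hs; rewrite !ler_norml ltr_norml.
by move=> /andP[h1 h2] /andP[h3 h4]; apply/andP; split; lra.
Qed.

(** With q = m^(-1/6), the range of y goes from m^(-1/2) to m^(-1/3): the lower
end is where the window 1/y is as wide as the standard deviation of X, and at
the upper end the pairing error y sqrt m is still much smaller than 1/y. The
range is long enough to produce a constant proportion of log m. *)
Lemma prb_low_ge (q : R) : 0 < q -> q ^+ 3 * Num.sqrt m%:R = 1 -> q <= 4800^-1 ->
  q ^+ 3 <= y <= q ^+ 2 ->
  q ^+ 3 / (100 * y) <= prb (fun A : {set 'I_m.+1} => `|hfun A y| < 1) :> R.
Proof.
move=> q0 qm q1 /andP[qy yq].
have q30 : 0 < q ^+ 3 by rewrite exprn_gt0.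
have y0 : 0 < y by apply: lt_le_trans qy.
have y1 : y < 1.
  by apply: le_lt_trans yq _; nra.
set S := Num.sqrt m%:R in qm.
have S0 : 0 < S by rewrite -(pmulr_rgt0 _ q30) qm.
have S1 : 1 <= S.
  have : q ^+ 3 <= 1 by rewrite exprn_ile1 //; lra.
  by nra.
have Sm : S ^+ 2 = m%:R by rewrite sqr_sqrtr.
apply: le_trans (prb_low_ge_rad y0 y1).
pose K := (Num.truncn (12 * (y * S))).+1.
have yS : 1 <= y * S by rewrite -qm ler_pM2r.
have /andP[K1 K2] := @truncn_itv _ (12 * (y * S)) (ltac:(nra)).
have K13 : K%:R <= 13 * (y * S) by rewrite /K -natr1; lra.
have l0 : 0 < (4 * y)^-1 by rewrite invr_gt0 mulr_gt0.
have h := @small_ball (4 * y)^-1 K l0 isT _.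
apply: le_trans (h _); last first.
  rewrite ler_pdivlMr ?mulr_gt0 //.
  have sq : Num.sqrt m.+1%:R <= 3 / 2 * S.
    rewrite -(@ler_pXn2r _ 2) ?nnegrE ?mulr_ge0 ?sqrtr_ge0 ?(ltW S0) //.
    rewrite exprMn Sm sqr_sqrtr // -natr1.
    have : 1 <= S ^+ 2 by rewrite expr_ge1 // ltW.
    by rewrite Sm; lra.
  by apply: le_trans (ltW K2); nra.
have k0 : 0 < K%:R :> R by rewrite ltr0n.
have a1 : q ^+ 3 / (50 * y) <= 9 / (32 * K%:R).
  rewrite ler_pdivrMr ?mulr_gt0 // mulrAC ler_pdivlMr ?mulr_gt0 //.
  have : q ^+ 3 * K%:R <= 13 * y.
    apply: (@le_trans _ _ (q ^+ 3 * (13 * (y * S)))); first by rewrite ler_pM2l.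
    by rewrite -[leRHS]mulr1 -qm le_eqVlt; apply/orP; left; apply/eqP; ring.
  lra.
have a2 : (m.+1%:R * y ^+ 2 + 1) / (4 * y)^-1 ^+ 2 <= q ^+ 3 / (100 * y).
  rewrite exprVn invrK ler_pdivlMr ?mulr_gt0 //.
  have m1 : m.+1%:R <= 2 * S ^+ 2.
    have : 1 <= S ^+ 2 by rewrite expr_ge1 // ltW.
    by rewrite -natr1 Sm; lra.
  have y2 : y ^+ 2 <= q ^+ 4.
    by rewrite (exprM q 2 2) ler_pXn2r ?nnegrE ?exprn_ge0 ?(ltW y0) ?(ltW q0).
  have y3 : y ^+ 3 <= q ^+ 6.
    by rewrite (exprM q 2 3) ler_pXn2r ?nnegrE ?exprn_ge0 ?(ltW y0) ?(ltW q0).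
  have q2S : q ^+ 6 * S ^+ 2 = 1 by rewrite (exprM q 3 2) -exprMn qm expr1n.
  have b1 : m.+1%:R * y ^+ 2 * q ^+ 2 <= 2.
    apply: (@le_trans _ _ (2 * S ^+ 2 * q ^+ 4 * q ^+ 2)).
      rewrite ler_pM2r ?exprn_gt0 //.
      by apply: ler_pM; rewrite ?sqr_ge0.
    by rewrite -[leRHS]mulr1 -q2S le_eqVlt; apply/orP; left; apply/eqP; ring.
  set W := m.+1%:R * y ^+ 2 + 1; set V := m.+1%:R * y ^+ 2 * q ^+ 2 + q ^+ 2.
  have h1 : y ^+ 3 * W <= q ^+ 6 * W.
    by apply: ler_wpM2r => //; rewrite addr_ge0 // mulr_ge0 ?sqr_ge0.
  have h2 : q ^+ 6 * W = q ^+ 3 * (q * V) by rewrite /W /V; ring.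
  have q2 : q ^+ 2 <= 1 by rewrite exprn_ile1 //; lra.
  have h3 : q * V <= 4800^-1 * 3.
    apply: ler_pM => //; [exact: ltW | | rewrite /V; lra].
    by apply: addr_ge0; [apply: mulr_ge0; [apply: mulr_ge0; [exact: ler0n|exact: sqr_ge0]|exact: sqr_ge0]|exact: sqr_ge0].
  have h4 : q ^+ 3 * (q * V) <= q ^+ 3 * (4800^-1 * 3) by rewrite ler_wpM2l // ltW.
  have -> : W * (4 * y) ^+ 2 * (100 * y) = 1600 * (y ^+ 3 * W) by ring.
  move: h1 h4; rewrite h2; move: (y ^+ 3 * W) (q ^+ 3 * (q * V)) (q ^+ 3) => A B C.
  by lra.
have : q ^+ 3 / (50 * y) = q ^+ 3 / (100 * y) + q ^+ 3 / (100 * y).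
  by field; rewrite gt_eqF.
lra.
Qed.

End SmallBall.

(** * Zeros from sign changes *)

Section ZeroLower.
Context {R : realType} {m : nat}.
Implicit Types (A : {set 'I_m.+1}) (n : nat).

Lemma uniq_separated (s : seq nat) (l r z : nat -> R) : uniq s ->
  (forall b, b \in s -> l b < z b <= r b) ->
  (forall b b', (b < b')%N -> r b <= l b') -> uniq (map z s).
Proof.
move=> us zP lr; rewrite map_inj_in_uniq // => b b' bs b's e.
have /andP[h1 h2] := zP b bs; have /andP[h3 h4] := zP b' b's.
by case: (ltngtP b b') => // /lr h; exfalso; move: h1 h2 h3 h4 h; rewrite e; lra.
Qed.

Lemma Z_ge_intervals n A (s : seq nat) (l r : nat -> R) : (m <= n)%N -> uniq s ->
  (forall b, b \in s -> 0 <= l b /\ r b <= 2 * pi) ->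
  (forall b b', (b < b')%N -> r b <= l b') ->
  (forall b, b \in s -> exists2 z, l b < z < r b & outcome_poly n A z = 0) ->
  (forall b, b \in s -> exists x : R, outcome_poly n A x != 0) ->
  (size s <= Z (@outcome_poly R m n A))%N.
Proof.
move=> mn us lr0 lr sz nz.
have [->//|s0] := eqVneq s [::].
have [b0 b0s] : exists b, b \in s by case: s s0 {us lr0 sz nz} => // b s _; exists b; rewrite inE eqxx.
pose z b : R := if pselect (exists2 z, l b < z < r b & outcome_poly n A z = 0)
  is left h then projT1 (cid2 h) else 0.
have zP b : b \in s -> l b < z b < r b /\ outcome_poly n A (z b) = 0.
  move=> bs; rewrite /z; case: pselect => [h|/(_ (sz b bs))//].
  by case: (cid2 h).
rewrite -(size_map z); apply: Z_ge.
- exact: outcome_poly_uniq_zeros mn (nz b0 b0s).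
- apply: (@uniq_separated s l r z us) => // b /zP[/andP[h1 h2] _].
  by rewrite h1 ltW.
- move=> _ /mapP[b bs ->]; have [/andP[h1 h2] h3] := zP b bs.
  have [h4 h5] := lr0 b bs; split=> //; apply/andP; split; lra.
Qed.

Lemma continuous_outcome_poly n A : continuous (@outcome_poly R m n A).
Proof.
have -> : outcome_poly n A =
    horner (\sum_(0 <= k < n.+1) cheb k - cpoly A) \o cos :> (R -> R).
  by apply/funext => x; rewrite outcome_polyE.
by move=> x; apply: continuous_comp; [exact: continuous_cos | exact: continuous_horner].
Qed.

Lemma outcome_poly_ivt n A (a b : R) : a < b ->
  outcome_poly n A a * outcome_poly n A b < 0 ->
  exists2 z, a < z < b & outcome_poly n A z = 0.
Proof.
move=> ab h.
have [||c + c0] := @IVT _ (outcome_poly n A) a b 0 (ltW ab).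
- by apply: continuous_subspaceT; exact: continuous_outcome_poly.
- by rewrite ge_min le_max; case: (lerP (outcome_poly n A a) 0) => ha;
    case: (lerP (outcome_poly n A b) 0) => hb //=; nra.
rewrite in_itv /= => /andP[ac cb]; exists c => //.
rewrite !lt_neqAle ac cb !andbT; apply/andP; split; apply: contraTneq h.
  by move=> ->; rewrite c0 mul0r ltxx.
by move=> <-; rewrite c0 mulr0 ltxx.
Qed.

Definition strict_low_grid n A : nat :=
  count (fun j => `|hfun A (grid n j : R)| < 1) (iota 0 n).

(** At a grid point the oscillation is (-1)^j, so that it decides the sign of f
as soon as |h| < 1. *)
Lemma outcome_poly_grid n A j : (j <= n)%N -> `|hfun A (grid n j : R)| < 1 ->
  0 < (-1) ^+ j * outcome_poly n A (grid n j : R).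
Proof.
move=> jn hj; have pi0 := pi_gt0 R; have y0 := @grid_gt0 R n j.
have ypi : grid n j <= pi :> R by rewrite -(grid_max n) grid_le.
have s0 : 0 < sin (grid n j / 2 : R) by apply: sin_gt0_pi; lra.
have s20 : 0 < 2 * sin (grid n j / 2 : R) by rewrite mulr_gt0.
rewrite -(pmulr_rgt0 _ s20) mulrCA outcome_poly_sin sin_grid mulrBr -exprMn.
rewrite mulN1r opprK expr1n subr_gt0; apply: le_lt_trans hj.
by apply: le_trans (ler_norm _) _; rewrite normrM normrX normrN1 expr1n mul1r.
Qed.

(** Grid points with |h| < 1 are of two kinds. If the next one also has |h| < 1,
then f changes sign in between; otherwise |h| reaches 1 in between, which
happens at most as often as the level polynomial has roots. *)
Lemma strict_low_grid_le n A : (m <= n)%N ->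
  (strict_low_grid n A <= Z (@outcome_poly R m n A) + (m.*2).+4)%N.
Proof.
move=> mn; pose p j := `|hfun A (grid n j : R)| < 1.
rewrite /strict_low_grid -size_filter -/p.
rewrite -(count_predC (fun j => p j.+1) [seq j <- iota 0 n | p j]) -!size_filter.
apply: leq_add.
  apply: (@Z_ge_intervals n A _ (grid n) (grid n \o succn)) => //.
  - by rewrite !filter_uniq ?iota_uniq.
  - move=> j; rewrite !mem_filter mem_iota /= => /andP[_ /andP[_ jn]].
    have := @grid_gt0 R n j; have := @grid_le R n j.+1 n jn; rewrite grid_max.
    have := pi_gt0 R; split; lra.
  - by move=> j j' jj'; exact: grid_le.
  - move=> j; rewrite !mem_filter mem_iota /= => /andP[p1 /andP[p0 jn]].
    have h0 := outcome_poly_grid (ltnW jn) p0; have h1 := outcome_poly_grid jn p1.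
    apply: outcome_poly_ivt; first exact: grid_lt.
    have := mulr_gt0 h0 h1; rewrite exprS mulN1r mulrACA mulrN -expr2 sqrr_sign.
    by rewrite mulN1r oppr_gt0.
  - move=> j; rewrite !mem_filter mem_iota /= => /andP[_ /andP[p0 jn]].
    exists (grid n j); apply: contraTneq (outcome_poly_grid (ltnW jn) p0) => ->.
    by rewrite mulr0 ltxx.
set s := [seq j <- _ | _].
have sP j : j \in s -> exists2 c : R, grid n j <= c <= grid n j.+1 & hfun A c ^+ 2 = 1.
  rewrite !mem_filter mem_iota /= => /andP[p1 /andP[p0 jn]].
  apply: level_root; first exact: grid_le.
  rewrite /p -leNgt in p1; left; apply/andP; split.
    by rewrite -real_normK ?num_real // expr_le1 // ltW.
  by rewrite -real_normK ?num_real // expr_ge1.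
pose c j : R := if pselect (exists2 c : R, grid n j <= c <= grid n j.+1 & hfun A c ^+ 2 = 1)
  is left h then projT1 (cid2 h) else 0.
have cP j : j \in s -> grid n j < c j <= grid n j.+1 /\ hfun A (c j) ^+ 2 = 1.
  move=> js; rewrite /c; case: pselect => [h|/(_ (sP j js))//].
  case: (cid2 h) => x /= /andP[h1 h2] h3; split => //; rewrite h2 andbT.
  rewrite lt_neqAle h1 andbT; apply: contraTneq js => e.
  apply/negP; rewrite !mem_filter => /andP[_ /andP[+ _]]; rewrite /p e => p0.
  have : `|hfun A x| ^+ 2 < 1 by rewrite expr_lt1.
  by rewrite real_normK ?num_real // h3 ltxx.
rewrite -(size_map c); apply/ltnW; apply: leq_trans (size_level A).
apply: cos_poly_roots; first exact: level_neq0.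
  apply: (@uniq_separated s (grid n) (grid n \o succn) c).
  - by rewrite !filter_uniq ?iota_uniq.
  - by move=> j /cP[].
  - by move=> j j'; exact: grid_le.
move=> _ /mapP[j js ->]; have [/andP[h1 h2] h3] := cP j js.
rewrite horner_level h3 subrr; split=> //.
move: js; rewrite !mem_filter mem_iota /= => /andP[_ /andP[_ jn]].
have := @grid_gt0 R n j; have := @grid_le R n j.+1 n jn; rewrite grid_max.
by move=> h4 h5; apply/andP; split; lra.
Qed.

End ZeroLower.

(** * Sign changes at scale 1/m *)

Section BlockSignChange.
Context {R : realType} {m : nat}.
Implicit Types (A : {set 'I_m.+1}) (i j b : nat).

(** The spacing is chosen so that (m + 1/2) times a node is a multiple of pi,
which makes the Dirichlet kernel equal to 1/2 at all sums and
differences of distinct nodes, and hence the values of X at distinct nodes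
uncorrelated up to O(1). *)
Definition node i : R := 2 * pi * i%:R / (m.*2.+1)%:R.

Let M0 : 0 < (m.*2.+1)%:R :> R. Proof. by rewrite ltr0n. Qed.

Let Mn : (m.*2.+1)%:R = 2 * m%:R + 1 :> R.
Proof. by rewrite -natr1 -muln2 natrM; ring. Qed.

Lemma node_ge0 i : 0 <= node i.
Proof. by rewrite divr_ge0 ?mulr_ge0 ?pi_ge0. Qed.

Lemma node_lt i j : (i < j)%N -> node i < node j.
Proof.
by move=> ij; rewrite ltr_pM2r ?invr_gt0 // ltr_pM2l ?mulr_gt0 ?pi_gt0 // ltr_nat.
Qed.

Lemma node_le i j : (i <= j)%N -> node i <= node j.
Proof. by rewrite leq_eqVlt => /predU1P[->//|/node_lt/ltW]. Qed.

Lemma node_le_pi i : (i <= m)%N -> node i <= pi.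
Proof.
move=> im; rewrite ler_pdivrMr // -subr_ge0.
have : i%:R <= m%:R :> R by rewrite ler_nat.
rewrite -natr1 -addnn natrD; have := pi_gt0 R; nra.
Qed.

Lemma node_ge_half_pi i : (m.*2.+1 <= 4 * i)%N -> pi / 2 <= node i.
Proof.
move=> mi; rewrite ler_pdivlMr // -subr_ge0.
have : (m.*2.+1)%:R <= 4 * i%:R :> R by rewrite -natrM ler_nat.
have := pi_gt0 R; nra.
Qed.

Lemma dir_node i : (0 < i)%N -> (i < m.*2.+1)%N -> dir m (node i) = 2^-1.
Proof.
move=> i0 im; have pi0 := pi_gt0 R.
have i0' : 0 < i%:R :> R by rewrite ltr0n.
have im' : i%:R < (m.*2.+1)%:R :> R by rewrite ltr_nat.
have s0 : 0 < sin (node i / 2).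
  apply: sin_gt0_pi; apply/andP; split.
    by rewrite divr_gt0 // divr_gt0 // !mulr_gt0.
  rewrite /node ltr_pdivrMr // ltr_pdivrMr // -subr_gt0; nra.
have e : sin ((m%:R + 2^-1) * node i) = 0.
  have -> : (m%:R + 2^-1) * node i = i%:R * pi.
    by rewrite /node [X in _ / X]Mn; field; rewrite -Mn lt0r_neq0.
  elim: (i) => [|k IH]; first by rewrite mul0r sin0.
  by rewrite -natr1 mulrDl mul1r sinDpi IH oppr0.
have := dirichletE m (node i); rewrite e addr0 => h.
apply: (mulfI (lt0r_neq0 s0)); lra.
Qed.

Lemma sum_cos_cos i j : (i <= m)%N -> (j <= m)%N -> (0 < i)%N -> (0 < j)%N ->
  \sum_(k : 'I_m.+1) cos (k%:R * node i) * cos (k%:R * node j) =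
  2^-1 + (i == j)%:R * (m%:R / 2 + 4^-1) :> R.
Proof.
wlog ij : i j / (i <= j)%N.
  move=> H im jm i0 j0; have [ij|/ltnW ij] := leqP i j; first exact: H.
  by rewrite eq_sym -H //; apply: eq_bigr => k _; rewrite mulrC.
move=> im jm i0 j0.
have -> : \sum_(k : 'I_m.+1) cos (k%:R * node i) * cos (k%:R * node j) =
    2^-1 * (dir m (node (i + j)) + dir m (node (j - i))).
  rewrite /dir !big_mkord -big_split mulr_sumr; apply: eq_bigr => k _ /=.
  have -> : k%:R * node (i + j) = k%:R * node j + k%:R * node i.
    by rewrite /node natrD; ring.
  have -> : k%:R * node (j - i) = k%:R * node j - k%:R * node i.
    by rewrite /node natrB //; ring.
  by rewrite cosD cosB; field.
rewrite (@dir_node (i + j)); [|lia|lia].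
have [->|nij] := eqVneq i j.
  rewrite subnn /dir (eq_big_nat _ _ (F2 := fun=> 1)); last first.
    by move=> k _; rewrite /node mulr0 mul0r mulr0 cos0.
  by rewrite big_mkord sumr_const card_ord -natr1 /= mulr1n; field.
by rewrite dir_node /= ?mulr0n; [field|lia|lia].
Qed.

Let v : R := m%:R / 2 + 3 / 4.
Let sigma : R := Num.sqrt v.

Definition nodes b : seq nat := iota (9 * b).+1 9.

Lemma nodesP b i : (9 * b + 9 <= m)%N -> i \in nodes b -> (0 < i <= m)%N.
Proof. by rewrite mem_iota; lia. Qed.

Lemma sum_nodes b (c : R) : \sum_(i <- nodes b) c = 9 * c.
Proof. by rewrite /nodes /= !big_cons big_nil; ring. Qed.

(** The threshold 3 exceeds what the deterministic part of f can compensate for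
nodes in [pi/2, pi]; see [mixed_block_zero]. *)
Definition mixed_block b A : bool :=
  has (fun i => 3 <= signed_sum (node i) A) (nodes b) &&
  has (fun i => signed_sum (node i) A <= - 3) (nodes b).

(** This is twice the smaller of the sums of the positive and of the negative
parts: it is large only if both signs occur with large values. *)
Definition spread b A : R := \sum_(i <- nodes b) `|signed_sum (node i) A|
  - `|\sum_(i <- nodes b) signed_sum (node i) A|.

Lemma spread_small b A : ~~ mixed_block b A -> spread b A <= 54.
Proof.
rewrite negb_and -!all_predC => h; rewrite /spread.
set x := fun i => signed_sum (node i) A in h *.
have size9 : \sum_(i <- nodes b) 6 = 54 :> R by rewrite sum_nodes; ring.
case/orP: h => /allP h.
  have e : \sum_(i <- nodes b) `|x i| - 54 <= - \sum_(i <- nodes b) x i.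
    rewrite -size9 -sumrB -sumrN; apply: ler_sum_in => i /h /=.
    rewrite -ltNge -/(x i) => h3; case: (ler0P (x i)) => _; lra.
  have := ler_norm (- \sum_(i <- nodes b) x i); rewrite normrN; lra.
have e : \sum_(i <- nodes b) `|x i| - 54 <= \sum_(i <- nodes b) x i.
  rewrite -size9 -sumrB; apply: ler_sum_in => i /h /=.
  rewrite -ltNge -/(x i) => h3; case: (ler0P (x i)) => _; lra.
have := ler_norm (\sum_(i <- nodes b) x i); lra.
Qed.

Lemma avg_node2 i : (0 < i <= m)%N ->
  avg (fun A : {set 'I_m.+1} => signed_sum (node i) A ^+ 2) = v :> R.
Proof.
move=> /andP[i0 im]; rewrite avg_rad2 ?index_enum_uniq //.
have := sum_cos_cos im im i0 i0; rewrite eqxx mul1r => e.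
transitivity (2^-1 + (m%:R / 2 + 4^-1) : R); last by rewrite /v; field.
by rewrite -e; apply: eq_bigr => k _; rewrite expr2.
Qed.

Lemma avg_node4 i : (0 < i <= m)%N ->
  avg (fun A : {set 'I_m.+1} => signed_sum (node i) A ^+ 4) <= 3 * v ^+ 2 :> R.
Proof.
move=> im; apply: le_trans (avg_rad4 _ _) _; first exact: index_enum_uniq.
by rewrite -(@avg_node2 i im) avg_rad2 // index_enum_uniq.
Qed.

Lemma avg_block2 b : (9 * b + 9 <= m)%N ->
  avg (fun A : {set 'I_m.+1} => (\sum_(i <- nodes b) signed_sum (node i) A) ^+ 2)
    = 9 * v + 36 :> R.
Proof.
move=> bm; pose a (k : 'I_m.+1) : R := \sum_(i <- nodes b) cos (k%:R * node i).
rewrite -(@eq_avg _ _ (fun A => rad (index_enum _) a A ^+ 2)); last first.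
  move=> A; congr (_ ^+ 2); rewrite /signed_sum /rad exchange_big /=.
  by apply: eq_bigr => k _; rewrite mulr_suml.
rewrite avg_rad2 ?index_enum_uniq //.
transitivity (\sum_(i <- nodes b) \sum_(j <- nodes b)
    (2^-1 + (i == j)%:R * (m%:R / 2 + 4^-1)) : R).
  have e2 k : a k ^+ 2 = \sum_(i <- nodes b) \sum_(j <- nodes b)
     cos (k%:R * node i) * cos (k%:R * node j).
    by rewrite expr2 /a big_distrlr.
  rewrite (eq_bigr _ (fun k _ => e2 k)).
  rewrite exchange_big /=; apply: eq_big_seq => i ib.
  rewrite exchange_big /=; apply: eq_big_seq => j jb.
  have /andP[i0 im] := nodesP bm ib; have /andP[j0 jm] := nodesP bm jb.
  exact: sum_cos_cos.
rewrite (eq_big_seq (fun=> v + 4)) => [|i ib].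
  by rewrite sum_nodes; ring.
rewrite big_split /= -mulr_suml -natr_sum.
rewrite (_ : (\sum_(j <- nodes b) (i == j))%N = 1%N).
  by rewrite sum_nodes /v; field.
rewrite (eq_bigr (fun j => if j == i then 1%N else 0%N)) => [|j _].
  by rewrite -big_mkcond sum1_count count_uniq_mem ?iota_uniq // ib.
by rewrite eq_sym; case: eqP.
Qed.

(** The difference is |x| (|x| - 2s)^2 (|x| + 4s) / (16 s^3). Applied at the
standard deviation, it bounds the first absolute moment from below by the
second and fourth moments. *)
Lemma norm_ge_quartic (x s : R) : 0 < s ->
  3 / (4 * s) * x ^+ 2 - (16 * s ^+ 3)^-1 * x ^+ 4 <= `|x|.
Proof.
move=> s0; rewrite -subr_ge0.
have e2 : x ^+ 2 = `|x| ^+ 2 by rewrite real_normK ?num_real.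
have -> : x ^+ 4 = `|x| ^+ 4 by rewrite (exprM x 2 2) e2 -exprM.
rewrite e2; have := normr_ge0 x; move: `|x| => t t0.
have -> : t - (3 / (4 * s) * t ^+ 2 - (16 * s ^+ 3)^-1 * t ^+ 4) =
    t * (t - 2 * s) ^+ 2 * (t + 4 * s) / (16 * s ^+ 3).
  by field; rewrite gt_eqF.
apply: divr_ge0; last by rewrite mulr_ge0 ?exprn_ge0 // ltW.
apply: mulr_ge0; first by apply: mulr_ge0 => //; exact: sqr_ge0.
by rewrite addr_ge0 // mulr_ge0 // ltW.
Qed.

Lemma norm_le_quadratic (x s : R) : 0 < s -> `|x| <= (2 * s)^-1 * x ^+ 2 + s / 2.
Proof.
move=> s0; rewrite -subr_ge0.
rewrite -[x ^+ 2]real_normK ?num_real //; have := normr_ge0 x; move: `|x| => t t0.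
have -> : (2 * s)^-1 * t ^+ 2 + s / 2 - t = (t - s) ^+ 2 / (2 * s).
  by field; rewrite gt_eqF.
by rewrite divr_ge0 ?sqr_ge0 // mulr_ge0 // ltW.
Qed.

(** With s the standard deviation at a node, the nine absolute values have total
mean at least 9 (9/16) s, whereas by orthogonality the sum is of size about
3 s, so that the mean of the spread is at least a constant times s. Outcomes
that are not mixed contribute at most 54 to that mean, and the mixed ones are
controlled by the second moment, so they have probability bounded below. *)
Lemma prb_mixed_block b : (9 * b + 9 <= m)%N -> 200 ^+ 2 <= m%:R :> R ->
  100^-1 <= prb (mixed_block b) :> R.
Proof.
move=> bm m0.
have v0 : 0 < v.
  have : 0 <= m%:R :> R by []. rewrite /v; lra.
have s0 : 0 < sigma by rewrite sqrtr_gt0.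
have s2 : sigma ^+ 2 = v by rewrite sqr_sqrtr // ltW.
have s135 : 135 <= sigma.
  rewrite leNgt; apply/negP => s135.
  have : sigma ^+ 2 < 135 * 135 by nra.
  by rewrite s2 /v; lra.
clearbody sigma; clear m0.
pose X i A := signed_sum (node i) A.
have lo : avg (fun A : {set 'I_m.+1} =>
    \sum_(i <- nodes b) (3 / (4 * sigma) * X i A ^+ 2 - (16 * sigma ^+ 3)^-1 * X i A ^+ 4)
    - ((2 * (4 * sigma))^-1 * (\sum_(i <- nodes b) X i A) ^+ 2 + (4 * sigma) / 2))
  <= avg (spread b) :> R.
  apply: ler_avg => A; apply: lerB.
    by apply: ler_sum => i _; exact: norm_ge_quartic.
  by apply: norm_le_quadratic; rewrite mulr_gt0.
have hi : avg (spread b) <= avg (fun A : {set 'I_m.+1} =>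
    54 + \sum_(i <- nodes b) ((2 * (9 * sigma))^-1 * X i A ^+ 2
      + (9 * sigma) / 2 * (mixed_block b A)%:R)) :> R.
  apply: ler_avg => A; have [mb|mb] := boolP (mixed_block b A).
    rewrite -[leLHS]add0r; apply: lerD; first by [].
    apply: (@le_trans _ _ (\sum_(i <- nodes b) `|X i A|)).
      by rewrite /spread gerBl.
    apply: ler_sum => i _; rewrite mulr1n mulr1.
    by apply: norm_le_quadratic; rewrite mulr_gt0.
  rewrite -[leLHS]addr0; apply: lerD; first exact: spread_small.
  apply: sumr_ge0 => i _; rewrite mulr0n mulr0 addr0 mulr_ge0 ?sqr_ge0 //.
  by rewrite invr_ge0 !mulr_ge0 // ltW.
have hiE : avg (fun A : {set 'I_m.+1} =>
    54 + \sum_(i <- nodes b) ((2 * (9 * sigma))^-1 * X i A ^+ 2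
      + (9 * sigma) / 2 * (mixed_block b A)%:R)) =
   54 + sigma / 2 + 81 / 2 * (sigma * prb (mixed_block b)) :> R.
  rewrite avgD avg_cst ?card_sets_gt0 // avg_sum.
  rewrite (eq_big_seq (fun=> (2 * (9 * sigma))^-1 * v + (9 * sigma) / 2 * prb (mixed_block b))).
    by rewrite sum_nodes -s2; field; rewrite gt_eqF.
  by move=> i /(nodesP bm) ib; rewrite avgD !avgZ avg_node2.
have loE : 81 / 16 * sigma - (9 * v + 36) / (8 * sigma) - 2 * sigma <= avg (fun A : {set 'I_m.+1} =>
    \sum_(i <- nodes b) (3 / (4 * sigma) * X i A ^+ 2 - (16 * sigma ^+ 3)^-1 * X i A ^+ 4)
    - ((2 * (4 * sigma))^-1 * (\sum_(i <- nodes b) X i A) ^+ 2 + (4 * sigma) / 2)) :> R.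
  rewrite avgD avgN avgD avg_cst ?card_sets_gt0 // avgZ avg_block2 // avg_sum.
  rewrite (_ : 81 / 16 * sigma - (9 * v + 36) / (8 * sigma) - 2 * sigma =
    \sum_(i <- nodes b) (9 / 16 * sigma) -
     ((2 * (4 * sigma))^-1 * (9 * v + 36) + (4 * sigma) / 2)); last first.
    by rewrite sum_nodes; field; rewrite gt_eqF.
  rewrite lerD2r; apply: ler_sum_in => i /(nodesP bm) ib.
  rewrite avgD avgN !avgZ avg_node2 //.
  have -> : 9 / 16 * sigma = 3 / (4 * sigma) * v - (16 * sigma ^+ 3)^-1 * (3 * v ^+ 2).
    by rewrite -s2; field; rewrite gt_eqF.
  rewrite lerD2l lerN2 ler_pM2l; first exact: avg_node4.
  by rewrite invr_gt0 mulr_gt0 // exprn_gt0.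
have e13 : (9 * v + 36) / (8 * sigma) <= 13 / 8 * sigma.
  by rewrite ler_pdivrMr ?mulr_gt0 // -s2; nra.
have : 81 / 16 * sigma - 13 / 8 * sigma - 2 * sigma <=
   54 + sigma / 2 + 81 / 2 * (sigma * prb (mixed_block b)).
  rewrite -hiE; apply: le_trans hi; apply: le_trans lo; apply: le_trans loE.
  by rewrite lerD2r lerD2l lerN2.
move: (prb (mixed_block b)) => p h.
have : 81 * (sigma * 100^-1) <= 81 * (sigma * p) by lra.
by rewrite !ler_pM2l.
Qed.

(** On [pi/2, pi] the Dirichlet kernel D_n differs from 1/2 by at most 1, hence
f + X/2 = D_n - 1/4 is at most 5/4 in absolute value at a node and |X| >= 3
decides the sign of f. *)
Lemma mixed_block_zero n A b : (9 * b + 9 <= m)%N -> (m <= n)%N -> (m.*2.+1 <= 4 * (9 * b).+1)%N ->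
  mixed_block b A ->
  (exists2 z : R, node (9 * b).+1 < z < node (9 * b + 9) & outcome_poly n A z = 0)
  /\ exists x : R, outcome_poly n A x != 0.
Proof.
move=> bm mn mb /andP[/hasP[i ib hi] /hasP[j jb hj]].
have dist k : k \in nodes b -> [/\ node (9 * b).+1 <= node k, node k <= node (9 * b + 9) &
    `|outcome_poly n A (node k) + (signed_sum (node k) A) / 2| <= 5 / 4].
  move=> kb; have /andP[k0 km] := nodesP bm kb.
  move: kb; rewrite mem_iota => kb.
  split; try by apply: node_le; lia.
  have pk : pi / 2 <= node k by apply: node_ge_half_pi; lia.
  have kp := node_le_pi km; have pi0 := pi_gt0 R.
  have sh : 2^-1 <= sin (node k / 2).
    apply: le_trans (@sin_cos_pi4 R).2 _.
    rewrite leNgt ltr_sin ?in_itv /=; lra.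
  rewrite signed_sumE dir_node; [|lia|lia].
  have -> : outcome_poly n A (node k) + (2 * csum A (node k) - 2^-1) / 2 =
    dir n (node k) - 4^-1 by rewrite /outcome_poly; field.
  have := dirichletE n (node k); have := sin_max ((n%:R + 2^-1) * node k).
  rewrite !ler_norml => /andP[h1 h2] h.
  have {}h : 2 * sin (node k / 2) * (dir n (node k) - 2^-1) = sin ((n%:R + 2^-1) * node k).
    by rewrite mulrBr h; field.
  move: (sin (node k / 2)) (sin ((n%:R + 2^-1) * node k)) (dir n (node k)) sh h1 h2 h => s t d.
  by move=> sh h1 h2 h; apply/andP; split; nra.
have [i1 i2 i3] := dist i ib; have [j1 j2 j3] := dist j jb.
move: i3 j3; rewrite !ler_norml => /andP[i3 i4] /andP[j3 j4].
have fi : outcome_poly n A (node i) < 0 by lra.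
have fj : 0 < outcome_poly n A (node j) by lra.
split; last by exists (node i); rewrite lt_eqF.
have prod : outcome_poly n A (node i) * outcome_poly n A (node j) < 0.
  by rewrite nmulr_rlt0.
case: (ltgtP i j) => ij; last by move: fi fj; rewrite ij; lra.
  have [z /andP[z1 z2] z0] := outcome_poly_ivt (node_lt ij) prod.
  by exists z => //; apply/andP; split; lra.
rewrite mulrC in prod; have [z /andP[z1 z2] z0] := outcome_poly_ivt (node_lt ij) prod.
by exists z => //; apply/andP; split; lra.
Qed.

(** The blocks whose nodes lie in [pi/2, pi] are disjoint and about m/18 in
number. *)
Lemma avg_Z_ge n : 200 ^+ 2 <= m%:R :> R -> (m <= n)%N ->
  m%:R / 3600 <= avg (fun A : {set 'I_m.+1} => (Z (@outcome_poly R m n A))%:R) :> R.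
Proof.
(* Blocks with index at least q have all nodes above pi/2, and those below
   m %/ 9 have all nodes at most pi. *)
move=> m0 mn; pose q := (m %/ 18).+1; pose B := (m %/ 9 - q)%N.
have bP b : b \in iota q B -> (9 * b + 9 <= m)%N /\ (m.*2.+1 <= 4 * (9 * b).+1)%N.
  by rewrite mem_iota /B /q; lia.
have m72 : (72 <= m)%N by rewrite -(ler_nat R); lra.
have pi0 := pi_gt0 R.
have cnt A : (count (fun b => mixed_block b A) (iota q B) <= Z (@outcome_poly R m n A))%N.
  rewrite -size_filter.
  apply: (@Z_ge_intervals _ _ n A _ (fun b => node (9 * b).+1) (fun b => node (9 * b + 9))) => //.
  - by rewrite filter_uniq ?iota_uniq.
  - move=> b; rewrite mem_filter => /andP[_ /bP[b1 b2]].
    by split; [exact: node_ge0 | have := node_le_pi b1; lra].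
  - by move=> b b' bb'; apply: node_le; lia.
  - by move=> b; rewrite mem_filter => /andP[mb /bP[b1 b2]];
      have [] := mixed_block_zero b1 mn b2 mb.
  - by move=> b; rewrite mem_filter => /andP[mb /bP[b1 b2]];
      have [] := mixed_block_zero b1 mn b2 mb.
apply: (@le_trans _ _ (avg (fun A : {set 'I_m.+1} => \sum_(b <- iota q B) (mixed_block b A)%:R))).
  rewrite avg_sum; apply: (@le_trans _ _ (\sum_(b <- iota q B) 100^-1)).
    rewrite big_const_seq count_predT size_iota iter_addr_0 -[leRHS]mulr_natl.
    have : m%:R <= 36 * B%:R :> R by rewrite -natrM ler_nat /B /q; lia.
    by lra.
  by apply: ler_sum_in => b /bP[b1 b2]; exact: prb_mixed_block.
apply: ler_avg => A; rewrite -natr_sum ler_nat; apply: leq_trans (cnt A).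
rewrite -sum1_count [leqRHS]big_mkcond /=; apply: eq_leq; apply: eq_bigr => b _; by case: ifP.
Qed.

End BlockSignChange.

(** * Logarithms as harmonic sums *)

Section HarmonicSums.
Context {R : realType}.

Lemma ln_succ_ge (k : nat) : ln (k.+2%:R) - ln (k.+1%:R) <= (k.+1%:R)^-1 :> R.
Proof.
have h : 0 < (k.+1%:R)^-1 :> R by rewrite invr_gt0.
rewrite -ln_div ?posrE // -[k.+2%:R]natr1 mulrDl divff ?pnatr_eq0 // mul1r.
by apply: le_ln1Dx; apply: lt_trans h; rewrite ltrN10.
Qed.

Lemma ln_succ_le (k : nat) : (k.+2%:R)^-1 <= ln (k.+2%:R) - ln (k.+1%:R) :> R.
Proof.
have h : (k.+2%:R)^-1 < 1 :> R by rewrite invf_lt1 ?ltr1n.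
have := @le_ln1Dx R (- (k.+2%:R)^-1); rewrite ltrN2 => /(_ h).
have -> : 1 - (k.+2%:R)^-1 = k.+1%:R / k.+2%:R :> R.
  rewrite -[k.+2%:R]natr1; have t0 : 0 < k.+1%:R :> R by [].
  by move: (k.+1%:R) t0 => t t0; field; rewrite gt_eqF //; lra.
by rewrite ln_div ?posrE // lerNr opprB.
Qed.

Lemma harmonic_le (a b : nat) : (0 < a)%N -> (a <= b)%N ->
  \sum_(a <= j < b) (j.+1%:R)^-1 <= ln (b%:R) - ln (a%:R) :> R.
Proof.
move=> a0 ab; rewrite -(telescope_sumr (fun j => ln (j%:R : R)) ab).
rewrite big_nat [leRHS]big_nat; apply: ler_sum => -[|j] /andP[aj _].
  by move: (leq_trans a0 aj).
exact: ln_succ_le.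
Qed.

Lemma harmonic_ge (a b : nat) : (a <= b)%N ->
  ln (b.+1%:R) - ln (a.+1%:R) <= \sum_(a <= j < b) (j.+1%:R)^-1 :> R.
Proof.
move=> ab; rewrite -(telescope_sumr (fun j => ln (j.+1%:R : R)) ab).
by apply: ler_sum => j _; exact: ln_succ_ge.
Qed.

Lemma ln2_ge_half : 2^-1 <= ln 2 :> R.
Proof.
have := @le_ln1Dx R (- 2^-1) ltac:(lra).
have -> : 1 - 2^-1 = 2^-1 :> R by field.
by rewrite lnV ?posrE //; lra.
Qed.

Lemma scaled_inv_le (c u w p : R) : 0 < c -> 0 < u -> u <= w -> 0 < p -> p < 4 ->
  c / (100 * 4) * w^-1 <= c / (100 * p) * u^-1.
Proof.
move=> c0 u0 uw p0 p4; have w0 := lt_le_trans u0 uw.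
apply: ler_pM; [by rewrite divr_ge0 ?mulr_ge0 // ltW | by rewrite invr_ge0 ltW | |].
  by rewrite ler_pM2l // lef_pV2 ?posrE ?mulr_gt0 // ler_pM2l // ltW.
by rewrite lef_pV2 ?posrE.
Qed.

End HarmonicSums.

(** * The upper bound *)

Section UpperBound.
Context {R : realType} {m n : nat}.
Local Notation EZ := (avg (fun A : {set 'I_m.+1} => (Z (@outcome_poly R m n A))%:R) : R).

(** With a = n / sqrt m, the first a grid points are counted with probability
at most 1, and the j-th one with probability O(a / j) otherwise. *)
Lemma avg_low_grid_le : (2 <= m)%N -> (m <= n)%N ->
  avg (fun A : {set 'I_m.+1} => (@low_grid R m n A)%:R) <=
    58 * (n%:R / Num.sqrt m%:R * ln m%:R) :> R.
Proof.
move=> m2 mn; have pi0 := pi_gt0 R.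
set S := Num.sqrt m%:R; set a := n%:R / S; set L := ln m%:R.
have m2' : 2 <= m%:R :> R by rewrite ler_nat.
have mn' : m%:R <= n%:R :> R by rewrite ler_nat.
have S2 : S ^+ 2 = m%:R by rewrite sqr_sqrtr.
have S0 : 0 < S by rewrite sqrtr_gt0 ltr0n ltnW.
have S1 : 1 <= S by nra.
have n0 : 0 < n%:R :> R by lra.
have L2 : ln 2 <= L by rewrite ler_ln ?posrE //; lra.
have L1 : 2^-1 <= L by apply: le_trans L2; exact: ln2_ge_half.
have a0 : 0 < a by rewrite divr_gt0.
have aS : a * S = n%:R by rewrite divfK ?gt_eqF.
have a1 : 1 <= a by rewrite ler_pdivlMr // mul1r; nra.
have an : a <= n%:R by nra.
have /andP[J1 J2] := truncn_itv (ltW a0); set J := (Num.truncn a).+1 in J2.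
have Jn : (J <= n.+1)%N by rewrite ltnS -(ler_nat R); apply: le_trans J1 an.
have pj j : (j <= n)%N -> prb (fun A : {set 'I_m.+1} => `|hfun A (grid n j : R)| <= 1)
    <= 36 * a * (j.+1%:R)^-1 :> R.
  move=> jn; have y0 := @grid_gt0 R n j.
  have ypi : grid n j <= pi :> R by rewrite -(grid_max n) grid_le.
  have m1 : (0 < m)%N by exact: ltnW.
  apply: le_trans (@prb_low_le R m (grid n j) m1 _) _; first by rewrite y0.
  have N0 : 0 < n%:R + 2^-1 :> R by rewrite addr_gt0.
  have hs : j.+1%:R / (6 * n%:R) <= sin (grid n j / 2 : R).
    apply: (@le_trans _ _ ((grid n j / 2) / pi)); last first.
      by apply: sin_ge_divpi; apply/andP; split; lra.
    rewrite /grid -natr1.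
    have -> : (j%:R + 2^-1) * pi / (n%:R + 2^-1) / 2 / pi =
       (j%:R + 2^-1) / (2 * (n%:R + 2^-1)) :> R.
      by field; rewrite !gt_eqF //; lra.
    rewrite ler_pdivrMr ?mulr_gt0 // mulrAC ler_pdivlMr ?mulr_gt0 //.
    have : 0 <= j%:R :> R by []. nra.
  have hs0 : 0 < j.+1%:R / (6 * n%:R) :> R by rewrite divr_gt0 ?mulr_gt0.
  have -> : 36 * a * (j.+1%:R)^-1 = 6 / (S * (j.+1%:R / (6 * n%:R))).
    have t0 : 0 < j.+1%:R :> R by [].
    rewrite /a; move: (j.+1%:R) (n%:R) t0 n0 => t u t0 u0.
    by field; rewrite !gt_eqF.
  have sg0 := lt_le_trans hs0 hs.
  rewrite -/S ler_pM2l // lef_pV2 ?posrE; [by rewrite ler_pM2l | exact: mulr_gt0 | exact: mulr_gt0].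
rewrite (@eq_avg _ _ _ (fun A : {set 'I_m.+1} => \sum_(0 <= j < n.+1) (`|hfun A (grid n j : R)| <= 1)%R%:R)); last first.
  move=> A; rewrite -natr_sum; congr _%:R; rewrite /low_grid -sum1_count big_mkcond /=.
  by rewrite /index_iota subn0; apply: eq_bigr => j _; case: ifP.
rewrite avg_sum (@big_cat_nat _ _ _ J) //=.
have p1 : \sum_(0 <= j < J) avg (fun A : {set 'I_m.+1} => (`|hfun A (grid n j : R)| <= 1)%R%:R) <= J%:R :> R.
  apply: (@le_trans _ _ (\sum_(0 <= j < J) 1)); last by rewrite sumr_const_nat subn0.
  by apply: ler_sum => j _; exact: prb_le1.
have p2 : \sum_(J <= j < n.+1) avg (fun A : {set 'I_m.+1} => (`|hfun A (grid n j : R)| <= 1)%R%:R)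
    <= 36 * a * (ln n.+1%:R - ln J%:R) :> R.
  apply: (@le_trans _ _ (\sum_(J <= j < n.+1) 36 * a * (j.+1%:R)^-1)).
    by rewrite big_nat [leRHS]big_nat; apply: ler_sum => j /andP[_ jn]; exact: pj.
  rewrite -mulr_sumr; apply: ler_wpM2l; first by rewrite mulr_ge0 // ltW.
  exact: (@harmonic_le R J n.+1 isT Jn).
have lnJ : ln n.+1%:R - ln J%:R <= 3 / 2 * L :> R.
  have h1 : ln a <= ln J%:R by rewrite ler_ln ?posrE ?ltr0n // ltW.
  have h2 : ln n.+1%:R <= ln (2 * (a * S)).
    have h : n.+1%:R <= 2 * (a * S) by rewrite aS -natr1; lra.
    by rewrite ler_ln ?posrE // (lt_le_trans _ h).
  have h3 : ln (2 * (a * S)) = ln 2 + ln a + ln S.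
    have aS0 : 0 < a * S by rewrite aS.
    by rewrite (@lnM R 2 (a * S)) ?posrE // (@lnM R a S) ?posrE // addrA.
  have h4 : L = ln S *+ 2 by rewrite -lnXn // S2.
  rewrite mulr2n in h4; lra.
have J3 : J%:R <= 2 * a by rewrite /J -natr1; lra.
have : a * (ln n.+1%:R - ln J%:R) <= a * (3 / 2 * L) by rewrite ler_pM2l.
have : a * 2^-1 <= a * L by rewrite ler_pM2l.
lra.
Qed.

Lemma avg_Z_le : (2 <= m)%N -> (m <= n)%N ->
  EZ <= 232 * (n%:R * ln m%:R / Num.sqrt m%:R + m%:R).
Proof.
move=> m2 mn.
have -> : n%:R * ln m%:R / Num.sqrt m%:R = n%:R / Num.sqrt m%:R * ln m%:R :> R.
  by rewrite mulrAC.
have m2' : 2 <= m%:R :> R by rewrite ler_nat.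
have B0 : 0 <= n%:R / Num.sqrt m%:R * ln m%:R :> R.
  by rewrite mulr_ge0 ?divr_ge0 ?sqrtr_ge0 ?ln_ge0 //; lra.
have [mn'|nm] := ltnP m n; last first.
  have : EZ <= avg (fun _ : {set 'I_m.+1} => 2 * m%:R).
    apply: ler_avg => A; rewrite -natrM ler_nat.
    by apply: leq_trans (Z_le_degree A mn) _; lia.
  by rewrite avg_cst ?card_sets_gt0 //; lra.
have low := avg_low_grid_le m2 mn.
apply: (@le_trans _ _ (avg (fun A : {set 'I_m.+1} => (16 * m%:R + 34) + 4 * (@low_grid R m n A)%:R))).
  apply: ler_avg => A; rewrite -!natrM -!natrD ler_nat.
  by apply: leq_trans (Z_le_low_grid A mn') _; lia.
rewrite avgD avgZ avg_cst ?card_sets_gt0 //; lra.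
Qed.

End UpperBound.

(** * The three lower bounds *)

Section LowerBound.
Context {R : realType} {m n : nat}.
Local Notation EZ := (avg (fun A : {set 'I_m.+1} => (Z (@outcome_poly R m n A))%:R) : R).

Lemma sum_prb_le_avg_Z : (m <= n)%N ->
  \sum_(0 <= j < n) prb (fun A : {set 'I_m.+1} => `|hfun A (grid n j : R)| < 1)
    <= EZ + (2 * m%:R + 4).
Proof.
move=> mn; rewrite -avg_sum -[X in _ + X](@avg_cst _ {set 'I_m.+1} _ card_sets_gt0) -avgD.
apply: ler_avg => A; rewrite -natr_sum -natrM -!natrD ler_nat.
apply: (@leq_trans (@strict_low_grid R m n A)); last first.
  by apply: leq_trans (strict_low_grid_le A mn) _; lia.
rewrite /strict_low_grid -sum1_count [leqRHS]big_mkcond /= /index_iota subn0.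
by apply: eq_leq; apply: eq_bigr => j _; case: ifP.
Qed.

(** Summing the lower bound of [prb_low_ge] over the grid points between q^3
and q^2 gives n / sqrt m times log (1/q) up to a constant, and log (1/q) is
(log m) / 6. *)
Lemma avg_Z_ge_log (q : R) : (2 <= m)%N -> (m <= n)%N -> 0 < q ->
  q ^+ 3 * Num.sqrt m%:R = 1 -> q <= 4800^-1 ->
  n%:R / Num.sqrt m%:R * ln m%:R <= 400 * (12 * (EZ + (2 * m%:R + 4))).
Proof.
move=> m2 mn q0 qm q1.
have q_le1 : q <= 1 by lra.
have qV : 144 <= q^-1 by rewrite -[144]invrK lef_pV2 ?posrE //; lra.
have low y := @prb_low_ge R m y q q0 qm q1; clear q1.
have q21 : q ^+ 2 <= 1 by rewrite exprn_ile1 // ltW.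
have pi0 := pi_gt0 R; have pi2 := pi_ge2 R.
have pi4 : pi < 4 :> R by have /andP[_] := pihalf_02 R; lra.
set S := Num.sqrt m%:R in qm *.
have S2 : S ^+ 2 = m%:R by rewrite sqr_sqrtr.
have S0 : 0 < S by rewrite sqrtr_gt0 ltr0n ltnW.
have m2' : 2 <= m%:R :> R by rewrite ler_nat.
have mn' : m%:R <= n%:R :> R by rewrite ler_nat.
have S1 : 1 <= S by nra.
have q30 : 0 < q ^+ 3 by rewrite exprn_gt0.
have q20 : 0 < q ^+ 2 by rewrite exprn_gt0.
set N : R := n%:R + 2^-1; have N0 : 0 < N by rewrite addr_gt0 //; lra.
have qN1 : 1 <= q ^+ 3 * N.
  rewrite -qm ler_pM2l // /N.
  have : S <= n%:R by nra.
  lra.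
have lnm : ln m%:R = 6 * ln q^-1 :> R.
  rewrite lnV ?posrE // -S2 lnXn //.
  have : ln (q ^+ 3 * S) = 0 by rewrite qm ln1.
  rewrite lnM ?posrE // lnXn // !mulr2n mulrS mulr2n => h; lra.
have t0 : 0 <= q ^+ 3 * N / pi by rewrite divr_ge0 ?mulr_ge0 // ltW.
have t1 : 0 <= q ^+ 2 * N / pi by rewrite divr_ge0 ?mulr_ge0 // ltW.
have /andP[a1 a2] := truncn_itv t0; have /andP[b1 b2] := truncn_itv t1.
set a := (Num.truncn (q ^+ 3 * N / pi)).+1 in a2.
set b := Num.truncn (q ^+ 2 * N / pi) in b1 b2.
have ratio : (12 * q)^-1 * a.+1%:R <= b.+1%:R.
  have h : a.+1%:R <= 3 * (q ^+ 3 * N).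
    have : q ^+ 3 * N / pi <= q ^+ 3 * N.
      by rewrite ler_pdivrMr //; nra.
    by rewrite /a -!natr1; lra.
  apply: (@le_trans _ _ ((12 * q)^-1 * (3 * (q ^+ 3 * N)))).
    by rewrite ler_pM2l // invr_gt0 mulr_gt0.
  apply: le_trans (ltW b2).
  have -> : (12 * q)^-1 * (3 * (q ^+ 3 * N)) = q ^+ 2 * N / 4.
    by field; rewrite gt_eqF.
  rewrite ler_pM2l ?mulr_gt0 // lef_pV2 ?posrE //; lra.
have lnratio : 2^-1 * ln q^-1 <= ln b.+1%:R - ln a.+1%:R :> R.
  rewrite -ln_div ?posrE //.
  have h : (12 * q)^-1 <= b.+1%:R / a.+1%:R by rewrite ler_pdivlMr.
  have h0 : 0 < (12 * q)^-1 by rewrite invr_gt0 mulr_gt0.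
  have h1 : q^-1 <= (b.+1%:R / a.+1%:R) ^+ 2.
    apply: (@le_trans _ _ ((12 * q)^-1 ^+ 2)).
      rewrite invfM; move: qV; move: q^-1 => r r144.
      have -> : (12^-1 * r) ^+ 2 = r * (r / 144) by field.
      have r0 : 0 < r by apply: lt_le_trans r144.
      by rewrite -[leLHS]mulr1 ler_pM2l // ler_pdivlMr // mul1r.
    by rewrite ler_pXn2r ?nnegrE ?(ltW h0) // divr_ge0.
  have : ln q^-1 <= ln ((b.+1%:R / a.+1%:R) ^+ 2 : R).
    by rewrite ler_ln ?posrE ?invr_gt0 ?exprn_gt0 // divr_gt0.
  by rewrite lnXn ?divr_gt0 // mulr2n; lra.
have lnq0 : 0 <= ln q^-1 by rewrite ln_ge0 // (le_trans _ qV) // ler1n.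
have ab : (a <= b)%N.
  rewrite -ltnS -(ltr_nat R) -[X in X < _]addr0.
  have : 0 < a%:R :> R by rewrite ltr0n.
  have : 1 <= (12 * q)^-1 by rewrite invfM; lra.
  by move: ratio; rewrite -natr1 => h1 h2 h3; nra.
have bn : (b <= n)%N.
  rewrite -(ler_nat R); apply: le_trans b1 _; rewrite ler_pdivrMr //.
  by rewrite /N; nra.
have sum1 : q ^+ 3 * N / (100 * 4) * (\sum_(a <= j < b) (j.+1%:R)^-1) <= EZ + (2 * m%:R + 4).
  apply: le_trans (sum_prb_le_avg_Z mn).
  rewrite [leRHS](@big_cat_nat _ _ _ a) //=; last exact: leq_trans ab bn.
  rewrite [X in _ <= _ + X](@big_cat_nat _ _ _ b) //=.
  rewrite -[leLHS]add0r; apply: lerD; first by apply: sumr_ge0 => j _; exact: prb_ge0.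
  rewrite -[leLHS]addr0; apply: lerD; last by apply: sumr_ge0 => j _; exact: prb_ge0.
  rewrite mulr_sumr [leLHS]big_nat [leRHS]big_nat; apply: ler_sum => j /andP[aj jb].
  have j0 : 0 < j%:R + 2^-1 :> R by rewrite ltr_wpDl.
  have aj' : a%:R <= j%:R :> R by rewrite ler_nat.
  have jb' : j.+1%:R <= b%:R :> R by rewrite ler_nat.
  rewrite -natr1 in jb'.
  apply: (@le_trans _ _ (q ^+ 3 / (100 * grid n j))).
    have -> : q ^+ 3 / (100 * grid n j) = q ^+ 3 * N / (100 * pi) * (j%:R + 2^-1)^-1.
      rewrite /grid -/N; move: (j%:R + 2^-1) j0 => u u0.
      clear -q0 pi0 u0 N0; clearbody N.
      by rewrite !invfM invrK; ring.
    apply: scaled_inv_le => //; first exact: mulr_gt0.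
    by rewrite -[j.+1%:R]natr1 lerD2l; lra.
  apply: low; apply/andP; split; rewrite /grid -/N.
    rewrite ler_pdivlMr // -ler_pdivrMr //; apply: le_trans (ltW a2) _; lra.
  rewrite ler_pdivrMr // -ler_pdivlMr //; apply: le_trans b1; lra.
have h1 : q ^+ 3 * N / (100 * 4) * (2^-1 * ln q^-1) <= EZ + (2 * m%:R + 4).
  apply: le_trans sum1; rewrite ler_pM2l; last by rewrite divr_gt0 ?mulr_gt0.
  by apply: le_trans lnratio _; exact: harmonic_ge.
have h2 : n%:R / S * ln q^-1 <= q ^+ 3 * N * ln q^-1.
  apply: ler_wpM2r => //; rewrite ler_pdivrMr // mulrAC qm mul1r /N; lra.
by rewrite lnm; lra.
Qed.

(** For y below 2 / (2m + 3) one has |h(y)| < 1 whatever the outcome. This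
handles bounded m and large n. *)
Lemma avg_Z_ge_linear : (m <= n)%N ->
  n%:R / (4 * m%:R + 6) - 1 <= EZ + (2 * m%:R + 4).
Proof.
move=> mn; apply: le_trans (sum_prb_le_avg_Z mn).
have pi0 := pi_gt0 R; have pi2 := pi_ge2 R.
have pi4 : pi < 4 :> R by have /andP[_] := pihalf_02 R; lra.
have m0 : 0 <= m%:R :> R by []. have n0 : 0 <= n%:R :> R by [].
set N : R := n%:R + 2^-1; have N0 : 0 < N by rewrite /N; lra.
set D : R := pi * (2 * m%:R + 3) / 2; have D0 : 0 < D by rewrite !mulr_gt0 //; lra.
have /andP[b1 b2] := truncn_itv (divr_ge0 (ltW N0) (ltW D0)).
set b := Num.truncn (N / D) in b1 b2.
have D3 : 3 <= D by rewrite /D; nra.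
have bn : (b <= n)%N.
  rewrite -ltnS -(ltr_nat R); apply: le_lt_trans b1 _.
  by rewrite ltr_pdivrMr // -natr1 /N; nra.
rewrite (@big_cat_nat _ _ _ b) //= -[leLHS]addr0; apply: lerD; last first.
  by apply: sumr_ge0 => j _; exact: prb_ge0.
apply: (@le_trans _ _ (\sum_(0 <= j < b) 1)).
  rewrite sumr_const_nat subn0.
  have : n%:R / (4 * m%:R + 6) <= N / D.
    rewrite ler_pdivrMr; last by lra.
    rewrite mulrAC ler_pdivlMr //.
    have D4 : D <= 4 * m%:R + 6 by rewrite /D; nra.
    by apply: ler_pM => //; [exact: ltW | rewrite /N; lra].
  by rewrite -natr1 in b2; lra.
rewrite [leLHS]big_nat [leRHS]big_nat; apply: ler_sum => j /andP[_ jb].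
rewrite -[leLHS](@avg_cst _ {set 'I_m.+1} 1 card_sets_gt0); apply: ler_avg => A.
suff -> : `|hfun A (grid n j : R)| < 1 by [].
have jb' : j.+1%:R <= b%:R :> R by rewrite ler_nat.
rewrite -natr1 in jb'.
have y0 := @grid_gt0 R n j.
have yD : grid n j * (2 * m%:R + 3) < 2 :> R.
  have h : j%:R + 1 <= N / D by apply: le_trans b1.
  rewrite ler_pdivlMr // in h.
  by rewrite /grid -/N mulrAC ltr_pdivrMr //; rewrite /D in h; nra.
have ypi : grid n j <= pi :> R.
  by rewrite -(grid_max n) grid_le // ltnW // (leq_trans jb).
have s1 : sin (grid n j / 2) <= grid n j / 2 :> R by apply: sin_le_id; lra.
have s0 : 0 < sin (grid n j / 2 : R) by apply: sin_gt0_pi; lra.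
have cs : `|csum A (grid n j : R)| <= m%:R + 1.
  apply: le_trans (ler_norm_sum _ _ _) _.
  apply: (@le_trans _ _ (\sum_(k in A) 1)); first by apply: ler_sum => k _; exact: cos_max.
  rewrite sumr_const natr1 ler_nat -[leqRHS]card_ord; exact: max_card.
have g1 : `|2 * csum A (grid n j : R) - 1| <= 2 * m%:R + 3.
  by move: cs; rewrite !ler_norml => /andP[h1 h2]; apply/andP; split; lra.
rewrite normrM gtr0_norm //.
apply: (@le_lt_trans _ _ (grid n j / 2 * (2 * m%:R + 3))); last by lra.
by apply: ler_pM => //; exact: ltW.
Qed.

(** The outcome A = {0} works: f(0) = n > 0, and
f(pi) = ((-1)^n - 1) / 2 <= 0. *)
Lemma avg_Z_ge_outcome : (2 <= m)%N -> (m <= n)%N -> (2 ^+ m.+1)^-1 <= EZ.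
Proof.
move=> m2 mn; pose A0 : {set 'I_m.+1} := [set ord0]%SET.
have pi0 := pi_gt0 R.
have cE x : csum A0 x = 1 :> R by rewrite /csum big_set1 mul0r cos0.
have f0 : 0 < outcome_poly n A0 (0 : R).
  rewrite /outcome_poly cE /dir; under eq_bigr do rewrite mulr0 cos0.
  rewrite sumr_const_nat subn0 -natr1 addrK ltr0n; lia.
have fpi : outcome_poly n A0 (pi : R) <= 0.
  have := outcome_poly_sin n A0 (pi : R); rewrite /hfun cE sin_pihalf.
  have -> : (n%:R + 2^-1) * pi = n%:R * pi + pi / 2 :> R by field.
  rewrite sin_alt => h.
  have : (-1) ^+ n <= 1 :> R by rewrite -signr_odd; case: (odd n) => //=; rewrite ?expr1 ?expr0; lra.
  lra.
have [z zI z0] : exists2 z : R, 0 <= z <= pi & outcome_poly n A0 z = 0.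
  have [||z + z0] := @IVT _ (outcome_poly n A0) 0 pi 0 (ltW pi0).
  - by apply: continuous_subspaceT; exact: continuous_outcome_poly.
  - by rewrite ge_min le_max fpi (ltW f0) orbT.
  by rewrite in_itv /=; exists z.
have Z1 : (1 <= Z (@outcome_poly R m n A0))%N.
  apply: (@Z_ge _ _ n.*2 [:: z]) => //.
    by apply: outcome_poly_uniq_zeros mn _; exists 0; rewrite gt_eqF.
  move=> x; rewrite inE => /eqP ->; split=> //.
  by move: zI => /andP[h1 h2]; apply/andP; split; lra.
rewrite /avg card_sets card_ord -[leLHS]mul1r ler_pM2r ?invr_gt0 ?exprn_gt0 //.
rewrite (bigD1 A0) //= -[leLHS]addr0; apply: lerD; first by rewrite ler1n.
by apply: sumr_ge0.
Qed.

End LowerBound.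

(** * Combining the bounds *)

Section Assembly.
Context {R : realType}.

Local Notation EZ m n := (avg (fun A : {set 'I_m.+1} => (Z (@outcome_poly R m n A))%:R) : R).
Local Notation bound m n := (n%:R * ln m%:R / Num.sqrt m%:R + m%:R : R).

Lemma sixth_root (m : nat) (K : R) : (0 < m)%N -> 0 < K -> expR (6 * ln K) <= m%:R ->
  exists q : R, [/\ 0 < q, q ^+ 3 * Num.sqrt m%:R = 1 & q <= K^-1].
Proof.
move=> m0 K0 Km; have m0' : 0 < m%:R :> R by rewrite ltr0n.
exists (expR (- (ln m%:R / 6))); split; first exact: expR_gt0.
  have -> : Num.sqrt m%:R = expR (ln m%:R / 2) :> R.
    rewrite -[RHS]ger0_norm ?expR_ge0 // -sqrtr_sqr -expRM_natl mulrC divfK //.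
    by rewrite lnK // posrE.
  rewrite -expRM_natl -expRD (_ : _ + _ = 0) ?expR0 //; by field.
have h : 6 * ln K <= ln m%:R.
  by rewrite -[leLHS]expRK ler_ln // posrE expR_gt0.
apply: (@le_trans _ _ (expR (ln K^-1))); last by rewrite lnK // posrE invr_gt0.
by rewrite ler_expR lnV ?posrE //; lra.
Qed.

(** The loss proportional to M in the bound for X is paid for by the bound
for M itself. *)
Lemma combine_lower (E X M k1 k2 : R) : 0 < k1 -> 0 < k2 -> 0 <= E -> 
  X <= k1 * (E + 4 * M) -> M <= k2 * E ->
  (k1 * (1 + 4 * k2) + k2)^-1 * (X + M) <= E.
Proof.
move=> k10 k20 E0 hX hM.
have k0 : 0 < k1 * (1 + 4 * k2) + k2 by rewrite addr_gt0 // mulr_gt0 // addr_gt0 // mulr_gt0.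
rewrite ler_pdivrMl // mulrDl; apply: lerD => //; apply: le_trans hX _.
by rewrite -mulrA ler_pM2l //; lra.
Qed.

Lemma log_part_le : exists2 k : R, 0 < k & exists T : R,
  forall m n : nat, (2 <= m)%N -> (m <= n)%N -> T <= m%:R ->
  n%:R * ln m%:R / Num.sqrt m%:R <= k * (EZ m n + 4 * m%:R).
Proof.
have K0 : 0 < 4800 :> R by lra.
exists (400 * 12); first by lra.
exists (expR (6 * ln 4800)) => m n m2 mn T1.
have [q [q0 qm q1]] := sixth_root (ltnW m2) K0 T1.
have h1 := avg_Z_ge_log m2 mn q0 qm q1.
have m2' : 2 <= m%:R :> R by rewrite ler_nat.
clear K0 T1 q q0 qm q1.
by rewrite mulrAC; lra.
Qed.

Lemma linear_part_le : exists2 k : R, 0 < k & exists T : R,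
  forall m n : nat, (m <= n)%N -> T <= m%:R -> m%:R <= k * EZ m n.
Proof.
exists 3600; first by lra.
exists (200 ^+ 2) => m n mn T2; have h2 := avg_Z_ge T2 mn; clear T2.
by lra.
Qed.

Lemma avg_Z_lower_large : exists2 c : R, 0 < c & exists T : R,
  forall m n : nat, (2 <= m)%N -> (m <= n)%N -> T <= m%:R -> c * bound m n <= EZ m n.
Proof.
have [k1 k10 [T1 h1]] := log_part_le; have [k2 k20 [T2 h2]] := linear_part_le.
exists (k1 * (1 + 4 * k2) + k2)^-1.
  by rewrite invr_gt0 addr_gt0 // mulr_gt0 // addr_gt0 // mulr_gt0.
exists (Num.max T1 T2) => m n m2 mn; rewrite ge_max => /andP[mT1 mT2].
apply: combine_lower => //; [|exact: h1|exact: h2].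
by apply: avg_ge0 => A; exact: ler0n.
Qed.

(** For bounded m the target is at most a constant times n. The linear bound
loses an additive constant, which is absorbed because E Z is bounded below. *)
Lemma avg_Z_lower_small (T : R) : exists2 c : R, 0 < c &
  forall m n : nat, (2 <= m)%N -> (m <= n)%N -> m%:R < T -> c * bound m n <= EZ m n.
Proof.
have [T0|T0] := leP T 0.
  by exists 1 => // m n _ _ mT; have := le_lt_trans (ler0n R m) (lt_le_trans mT T0); rewrite ltxx.
pose p : R := (2 ^+ (Num.truncn T).+1)^-1.
have p0 : 0 < p by rewrite invr_gt0 exprn_gt0.
pose k : R := (T + 1) * ((4 * T + 6) * (1 + (2 * T + 5) / p)).
have r0 : 0 <= (2 * T + 5) / p by rewrite divr_ge0 ?(ltW p0) //; lra.
have k0 : 0 < k by rewrite /k !mulr_gt0 //; lra.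
exists k^-1; first by rewrite invr_gt0.
move=> m n m2 mn mT; rewrite ler_pdivrMl //.
have m2' : 2 <= m%:R :> R by rewrite ler_nat.
have mn' : m%:R <= n%:R :> R by rewrite ler_nat.
have Ep : p <= EZ m n.
  apply: le_trans (avg_Z_ge_outcome m2 mn); rewrite lef_pV2 ?posrE ?exprn_gt0 //.
  rewrite ler_eXn2l ?ltr1n // ltnS truncn_ge_nat ?(ltW T0) //.
  exact: ltW.
have E0 := lt_le_trans p0 Ep.
have lin := @avg_Z_ge_linear R m n mn; move: (EZ m n) Ep E0 lin => E Ep E0 lin.
have nE : n%:R <= (4 * T + 6) * ((1 + (2 * T + 5) / p) * E).
  have h1 : n%:R <= (4 * m%:R + 6) * (E + (2 * m%:R + 5)).
    rewrite -ler_pdivrMl; last by lra.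
    rewrite [leLHS]mulrC. by lra.
  apply: le_trans h1 _; apply: ler_pM; [lra|lra|lra|].
  rewrite [leRHS]mulrDl mul1r lerD2l.
  apply: (@le_trans _ _ (2 * T + 5)); first by lra.
  by rewrite mulrAC ler_pdivlMr // ler_wpM2l //; lra.
have bn : n%:R * ln m%:R / Num.sqrt m%:R + m%:R <= (T + 1) * n%:R.
  have S1 : 1 <= Num.sqrt m%:R :> R.
    by rewrite -[leLHS]sqrtr1 ler_wsqrtr //; lra.
  have L0 : 0 <= ln m%:R :> R by rewrite ln_ge0 //; lra.
  have L1 : ln m%:R <= m%:R :> R.
    have := @le_ln1Dx R (m%:R - 1); rewrite (_ : 1 + (m%:R - 1) = m%:R); last by ring.
    by move=> h; apply: le_trans (h _) _; lra.
  have : n%:R * ln m%:R / Num.sqrt m%:R <= n%:R * ln m%:R :> R.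
    by rewrite ler_pdivrMr ?(lt_le_trans _ S1) // ler_peMr // mulr_ge0.
  have : n%:R * ln m%:R <= n%:R * T :> R.
    by rewrite ler_wpM2l //; lra.
  lra.
apply: le_trans bn _; rewrite /k -!mulrA ler_wpM2l //; lra.
Qed.

Lemma avg_Z_lower : exists2 c : R, 0 < c &
  forall m n : nat, (2 <= m)%N -> (m <= n)%N -> c * bound m n <= EZ m n.
Proof.
have [c1 c10 [T h1]] := avg_Z_lower_large; have [c2 c20 h2] := avg_Z_lower_small T.
exists (Num.min c1 c2); first by rewrite lt_min c10.
move=> m n m2 mn.
have b0 : 0 <= bound m n.
  by rewrite addr_ge0 // divr_ge0 ?sqrtr_ge0 // mulr_ge0 // ln_ge0 // ler1n ltnW.
have [mT|mT] := leP T m%:R.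
  by apply: le_trans (h1 m n m2 mn mT); rewrite ler_wpM2r // ge_min lexx.
by apply: le_trans (h2 m n m2 mn mT); rewrite ler_wpM2r // ge_min lexx orbT.
Qed.

End Assembly.

(** * The expected number of zeros *)

Lemma random_cos_polyE d (T : measurableType d) (R : realType) (P : probability T R)
    (n m : nat) (eps : 'I_m.+1 -> {RV P >-> bool}) (t : T) :
  random_cos_poly n eps t = outcome_poly n (outcome eps t).
Proof.
apply/funext => x; rewrite /random_cos_poly /outcome_poly /dir /csum; congr (_ - _).
rewrite [RHS]big_mkcond; apply: eq_bigr => k _; rewrite inE.
by case: (eps k t); rewrite ?mul1r ?mul0r.
Qed.

Theorem theorem1p2 (R : realType) :
  exists c C : R, 0 < c /\ 0 < C /\
    forall (m n : nat), (2 <= m)%N -> (m <= n)%N ->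
    forall (d : measure_display) (T : measurableType d) (P : probability T R)
           (eps : 'I_m.+1 -> {RV P >-> bool}),
      mutually_independent eps ->
      (forall k, bernoulli_half (eps k)) ->
      let EZ := ('E_P[fun t => (Z (random_cos_poly n eps t))%:R%R : R])%E in
      let bound := n%:R * ln m%:R / Num.sqrt m%:R + m%:R : R in
      ((c * bound)%:E <= EZ)%E /\ (EZ <= (C * bound)%:E)%E.
Proof.
have [c c0 lower] := @avg_Z_lower R.
exists c, 232; split; first exact: c0.
split; first by lra.
move=> m n m2 mn d T P eps ind ber EZ bound.
have -> : EZ = (avg (fun A : {set 'I_m.+1} => (Z (@outcome_poly R m n A))%:R))%:E.
  rewrite -(expectation_outcome _ ind ber) /EZ; congr expectation.
  by apply/funext => t; rewrite random_cos_polyE.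
by rewrite !lee_fin; split; [exact: lower | exact: avg_Z_le].
Qed.
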